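(* Let $P\subseteq\mathbb{R}^d$ be a simple polytope and let $\mathbf{c}$ be a generic cost vector such that the directed graph $G(P,\mathbf{c})$ is the Hasse diagram of a lattice $L$. Then for every $u<v$ in $L$, the order complex of the open interval $(u,v)$ is homotopy equivalent to a ball or a sphere of some dimension. Consequently the Möbius function satisfies $\mu_L(u,v)\in\{0,1,-1\}$ for all $u\le v$ in $L$.
   Context: A polytope is simple if for each vertex $v$ and each set of $i$ edges at $v$ there is an $i$-dimensional face containing $v$ and those edges. $\mathbf{c}$ is generic if it takes distinct values on distinct vertices of $P$. $G(P,\mathbf{c})$ is the 1-skeleton of $P$ with each edge oriented from the endpoint with smaller $\mathbf{c}$-value to the one with larger $\mathbf{c}$-value. The Hasse diagram of a finite poset has a directed edge $u\to v$ iff $v$ covers $u$. The order complex of a poset is the simplicial complex of its chains; $(u,v)=\{z: u<z<v\}$; $\mu_L$ is the Möbius function of $L$. *)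

(* Defs.v *)
From HB Require Import structures.
From mathcomp Require Import all_boot all_order all_algebra.
From mathcomp Require Import all_classical all_reals all_analysis.
Set Implicit Arguments.
Unset Strict Implicit.
Unset Printing Implicit Defensive.
Import Order.TTheory GRing.Theory Num.Theory.
Import numFieldNormedType.Exports.
Local Open Scope classical_set_scope.
Local Open Scope ring_scope.

Section Polytopes.
Variables (R : realType) (d : nat).
Implicit Types (P F E A : set 'rV[R]_d) (a c u v x : 'rV[R]_d).

Definition dotp a x : R := \sum_(i < d) a 0 i * x 0 i.

Definition affine_hull A : set 'rV[R]_d :=
  [set x | exists (n : nat) (p : 'I_n -> 'rV[R]_d) (l : 'I_n -> R),
    [/\ forall i, A (p i), \sum_i l i = 1 & x = \sum_i l i *: p i]].

Definition convex_hull A : set 'rV[R]_d :=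
  [set x | exists (n : nat) (p : 'I_n -> 'rV[R]_d) (l : 'I_n -> R),
    [/\ forall i, A (p i), forall i, 0 <= l i, \sum_i l i = 1
      & x = \sum_i l i *: p i]].

Definition polytope P : Prop :=
  exists s : seq 'rV[R]_d, P = convex_hull [set` s].

(* With a = 0 this includes the empty face and P itself. *)
Definition face P F : Prop :=
  exists (a : 'rV[R]_d) (b : R),
    (forall x, P x -> dotp a x <= b) /\ F = [set x | P x /\ dotp a x = b].

(* The affine hull of F is a translate of a linear subspace of dimension k;
   no k satisfies this when F is empty. *)
Definition has_dim F (k : nat) : Prop :=
  exists (x0 : 'rV[R]_d) (U : {vspace 'rV[R]_d}),
    \dim U = k /\ affine_hull F = [set x | x - x0 \in U].

Definition vertex P v : Prop := face P [set v].

Definition edge P E : Prop := face P E /\ has_dim E 1.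

Definition simple_polytope P : Prop :=
  polytope P /\
  forall v, vertex P v ->
  forall (i : nat) (E : 'I_i -> set 'rV[R]_d), injective E ->
    (forall j, edge P (E j) /\ E j v) ->
    exists F, [/\ face P F, has_dim F i, F v & forall j, E j `<=` F].

Definition generic_cost P c : Prop :=
  forall u v, vertex P u -> vertex P v -> dotp c u = dotp c v -> u = v.

Definition skeleton_arc P c u v : Prop :=
  [/\ vertex P u, vertex P v, edge P (convex_hull [set u; v])
    & dotp c u < dotp c v].

End Polytopes.

Section Posets.
Context {disp : Order.disp_t} {T : finPOrderType disp}.
Implicit Types (u v z : T).

Definition covers u v : Prop :=
  (u < v)%O /\ forall z, ~~ (u < z < v)%O.

Definition open_itv u v : {set T} := [set z | (u < z < v)%O]%SET.

Definition order_complex (A : {set T}) : {set {set T}} :=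
  [set S : {set T} | (S \subset A) &&
    [forall x in S, forall y in S, (x >=< y)%O]]%SET.

(* The first argument is fuel; #|T| is always enough, cf. mobiusxx and
   mobius_sum. *)
Fixpoint mobius_rec (n : nat) u v : int :=
  if n is m.+1 then
    if u == v then 1
    else if (u < v)%O then - \sum_(z | (u <= z < v)%O) mobius_rec m u z
    else 0
  else 0.

Definition mobius u v : int := mobius_rec #|T| u v.

Let below v := #|[pred z | (z < v)%O]|.

Let below_lt z v : (z < v)%O -> (below z < below v)%N.
Proof.
move=> zv; apply: proper_card; apply/properP; split.
  by apply/fintype.subsetP => w; rewrite !inE => /lt_trans; exact.
by exists z; rewrite !inE // ltxx.
Qed.

Let below_max v : (below v < #|T|)%N.
Proof.
rewrite -cardsT; apply: proper_card; apply/properP; split.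
  by apply/fintype.subsetP => w; rewrite !inE.
by exists v; rewrite !inE // ltxx.
Qed.

Let mobius_recE m n u v : (below v < m)%N -> (below v < n)%N ->
  mobius_rec m u v = mobius_rec n u v.
Proof.
elim: m n v => [//|m IH] [//|n] v; rewrite !ltnS => vm vn /=.
case: eqP => // _; case: ifP => // _; congr (- _).
apply: eq_bigr => z /andP[_ zv]; have zb := below_lt zv.
by apply: IH; [exact: leq_trans vm|exact: leq_trans vn].
Qed.

Lemma mobiusxx u : mobius u u = 1.
Proof.
by rewrite /mobius; have := below_max u; case: #|T| => //= n _; rewrite eqxx.
Qed.

Lemma mobius_sum u v : (u < v)%O -> \sum_(z | (u <= z <= v)%O) mobius u z = 0.
Proof.
move=> uv; rewrite (bigD1 v) /=; last by rewrite (ltW uv) lexx.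
rewrite [X in X + _](_ : _ = - \sum_(z | (u <= z < v)%O) mobius u z).
  rewrite addrC; apply/eqP; rewrite subr_eq0; apply/eqP.
  apply: eq_bigl => z; rewrite lt_neqAle -andbA; congr (_ && _).
  by rewrite andbC.
rewrite {1}/mobius (mobius_recE u (below_max v) (ltnSn (below v))) /=.
rewrite lt_eqF // uv; congr (- _); apply: eq_bigr => z /andP[_ zv].
exact: mobius_recE (below_lt zv) (below_max z).
Qed.

End Posets.

Section Topology.
Variable R : realType.

(* {within A, continuous f} is continuity of the restriction of f to the
   subspace A; the values of f off A are irrelevant. *)
Definition homotopic_in (X Y : topologicalType) (A : set X) (B : set Y)
    (f g : X -> Y) : Prop :=
  exists H : R * X -> Y,
    [/\ {within `[0, 1] `*` A, continuous H},
        set_fun (`[0, 1] `*` A) B H,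
        {in A, forall x, H (0, x) = f x}
      & {in A, forall x, H (1, x) = g x}].

Definition homotopy_equivalent (X Y : topologicalType) (A : set X) (B : set Y) :
    Prop :=
  exists (f : X -> Y) (g : Y -> X),
    [/\ {within A, continuous f} /\ set_fun A B f,
        {within B, continuous g} /\ set_fun B A g,
        homotopic_in A A (g \o f) id
      & homotopic_in B B (f \o g) id].

(* Points of the realization are given by barycentric coordinates. *)
Definition realization (T : finType) (K : {set {set T}}) : set {ptws T -> R} :=
  [set x | [/\ forall t, 0 <= x t, \sum_t x t = 1
             & [set t | x t != 0]%SET \in K]].

Definition unit_ball (n : nat) : set 'rV[R]_n :=
  [set x | \sum_(i < n) x 0 i ^+ 2 <= 1].

(* The sphere of dimension n - 1; it is empty for n = 0. *)
Definition unit_sphere (n : nat) : set 'rV[R]_n :=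
  [set x | \sum_(i < n) x 0 i ^+ 2 = 1].

End Topology.

Arguments homotopic_in R {X Y} A B f g.
Arguments homotopy_equivalent R {X Y} A B.
Arguments realization R {T} K.
Arguments unit_ball : clear implicits.
Arguments unit_sphere : clear implicits.

(* G(P, c) is the Hasse diagram of L, each z : L being identified with the
   vertex vtx z of P. *)
Definition skeleton_is_hasse_diagram (R : realType) (d : nat)
    (P : set 'rV[R]_d) (c : 'rV[R]_d) (disp : Order.disp_t)
    (L : finPOrderType disp) (vtx : L -> 'rV[R]_d) : Prop :=
  [/\ injective vtx, range vtx = [set v | vertex P v]
    & forall u v : L, skeleton_arc P c (vtx u) (vtx v) <-> covers u v].

(* Main.v *)
Require Import Defs.
From mathcomp Require Import all_boot all_order all_algebra.
From mathcomp Require Import all_classical all_reals all_analysis.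
From mathcomp Require Import ring lra.
Set Implicit Arguments.
Unset Strict Implicit.
Unset Printing Implicit Defensive.
Import Order.TTheory GRing.Theory Num.Theory.
Import numFieldNormedType.Exports.
Local Open Scope classical_set_scope.
Local Open Scope ring_scope.

(* Let A be the set of covers of u below v. The heart of the matter is that for
   S a set of covers of u and a another cover of u, a is not below the join of S.
   Indeed, since P is simple, S spans a face F of P at u that does not contain a;
   the sink t of F is an upper bound of S, and a directed path from u to t cannot
   leave F. The latter rests on the fact that the join of two covers of a common
   element is the sink of the 2-face they span, and both facts are proved by a
   simultaneous downward induction on L.

   Consequently S |-> join of S embeds the Boolean lattice of subsets of A in
   [u, v]. Rota's crosscut formula then gives the Moebius function, and the map r
   sending z to the join of the covers of u below z is homotopic to the identity on
   (u, v). If join A < v then r z <= join A contracts (u, v); otherwise (u, v) has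
   the homotopy type of the proper part of the Boolean lattice of A, a sphere of
   dimension #|A| - 2. *)

(** * Covers and induction in a finite poset *)

Section Covers.
Context {disp : Order.disp_t} {L : finPOrderType disp}.
Implicit Types x y z : L.

Lemma finord_ind_down (Q : L -> Prop) :
  (forall x, (forall y, (x < y)%O -> Q y) -> Q x) -> forall x, Q x.
Proof.
move=> IH x; move: {2}_.+1 (ltnSn #|[set y | (x < y)%O]%SET|) => n.
elim: n x => // n IHn x; rewrite ltnS => le_n; apply: IH => y xy; apply: IHn.
apply: leq_trans le_n; apply: proper_card; apply/properP; split.
  by apply/fintype.subsetP => z; rewrite !inE; exact: lt_trans.
by exists y; rewrite !inE ?ltxx.
Qed.

Lemma finord_ind_up (Q : L -> Prop) :
  (forall x, (forall y, (y < x)%O -> Q y) -> Q x) -> forall x, Q x.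
Proof.
move=> IH x; move: {2}_.+1 (ltnSn #|[set y | (y < x)%O]%SET|) => n.
elim: n x => // n IHn x; rewrite ltnS => le_n; apply: IH => y xy; apply: IHn.
apply: leq_trans le_n; apply: proper_card; apply/properP; split.
  by apply/fintype.subsetP => z; rewrite !inE => /lt_trans; exact.
by exists y; rewrite !inE ?ltxx.
Qed.

Lemma exists_cover_above x y : (x < y)%O -> exists2 z, covers x z & (z <= y)%O.
Proof.
elim/finord_ind_up: y => y IH xy.
have [[z /andP[xz zy]]|nz] := pselect (exists z, (x < z < y)%O).
  by have [w cw wz] := IH z zy xz; exists w => //; apply: le_trans wz (ltW zy).
exists y => //; split => // z; apply/negP => hz; apply: nz; exists z.
exact: hz.
Qed.

Lemma exists_cover_below x y : (x < y)%O -> exists2 z, covers z y & (x <= z)%O.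
Proof.
elim/finord_ind_down: x => x IH xy.
have [[z /andP[xz zy]]|nz] := pselect (exists z, (x < z < y)%O).
  by have [w cw zw] := IH z xz zy; exists w => //; apply: le_trans zw; exact: ltW.
exists x => //; split => // z; apply/negP => hz; apply: nz; exists z.
exact: hz.
Qed.

Lemma covers_le_eq x p q : covers x p -> covers x q -> (p <= q)%O -> p = q.
Proof.
move=> [xp _] [xq nq]; rewrite le_eqVlt => /orP[/eqP//|pq].
by have := nq p; rewrite xp pq.
Qed.

Definition adjacent x y := covers x y \/ covers y x.

(** Two combinatorial traces of being a 2-face: two edges at a vertex span the whole face, so any
    face containing both contains [Q]; and at most two edges of a polygon meet at a vertex. *)
Definition planar (isface : (L -> Prop) -> Prop) (Q : L -> Prop) :=
  (forall y z z', Q y -> Q z -> Q z' -> adjacent y z -> adjacent y z' ->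
     z <> z' ->
     forall G, isface G -> G y -> G z -> G z' -> forall w, Q w -> G w) /\
  (forall y z1 z2 z3, Q y -> Q z1 -> Q z2 -> Q z3 ->
     adjacent y z1 -> adjacent y z2 -> adjacent y z3 ->
     z1 <> z2 -> z1 <> z3 -> z2 <> z3 -> False).

End Covers.

(** * Joins of covers in a lattice with faces *)

Section FaceSystem.
Context {disp : Order.disp_t} {L : finLatticeType disp}.
(* A face is represented by the set of vertices it contains. *)
Variables (R : realType) (cost : L -> R) (isface : (L -> Prop) -> Prop).
Implicit Types (x y z p q t u w : L) (G Q : L -> Prop) (S : {set L}).

(** The interface between polytope and order: these properties are established further on for the
    vertex sets of the faces of a simple polytope, with [cost] given by the cost vector. *)
Hypothesis cost_inj : injective cost.
Hypothesis cost_covers : forall x y, covers x y -> cost x < cost y.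
Hypothesis face_ascent : forall G x y, isface G -> G x -> G y ->
  cost x < cost y -> exists2 z, covers x z & G z.
Hypothesis face_pair : forall x p q, covers x p -> covers x q -> p <> q ->
  exists Q, [/\ isface Q, planar isface Q, Q x, Q p & Q q].
Hypothesis face_span : forall x S, (forall z, z \in S -> covers x z) ->
  exists G, [/\ isface G, G x, forall z, z \in S -> G z
    & forall z, covers x z -> G z -> z \in S].

Lemma cost_lt x y : (x < y)%O -> cost x < cost y.
Proof.
elim/(@finord_ind_down _ L): x => x IH xy.
have [z xz zy] := exists_cover_above xy; have := cost_covers xz.
move: zy; rewrite le_eqVlt => /orP[/eqP->//|zy].
by move=> /lt_trans; apply; apply: IH => //; case: xz.
Qed.

(** The sink is the vertex of largest cost in [G]: from every other vertex of [G] an ascending edge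
    stays in [G], and following such edges ends there. *)
Lemma face_sink G x : isface G -> G x ->
  exists2 t, G t & forall y, G y -> (y <= t)%O.
Proof.
move=> fG Gx.
have [t /asboolP Gt tmax] :
    exists2 t, `[< G t >] & forall y, `[< G y >] -> cost y <= cost t.
  have /asboolP Gx' := Gx.
  by case: (@arg_maxP _ R L x (fun y => `[< G y >]) cost Gx') => t; exists t.
exists t => // y; elim/(@finord_ind_down _ L): y => y IH Gy.
have := tmax y; rewrite asboolT // => /(_ isT).
rewrite le_eqVlt => /orP[/eqP/cost_inj->//|yt].
have [z cz Gz] := face_ascent fG Gy Gt yt.
by apply: le_trans (IH z _ Gz); [apply: ltW|]; case: cz.
Qed.

(** The statement proved by downward induction: the sink of the 2-face spanned by two covers is
    below their join, hence equal to it. *)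
Let pair_ok x := forall p q, covers x p -> covers x q -> p <> q ->
  exists Q, [/\ isface Q, planar isface Q, Q x, Q p /\ Q q
    & forall y, Q y -> (y <= Order.join p q)%O].

(* A directed path leaving the face [G] never reaches the sink [t] of [G]: if
   [y -> p] leaves [G] and [y -> y'] stays in it, then in the 2-face [Q] through
   [y'] and [p], whose vertices are all below [t], some edge [y' -> p'] leaves [G]
   as well. Repeating this, an edge would leave [t] towards an element below [t]. *)
Let stay G t y p : isface G -> G t -> (forall z, G z -> (z <= t)%O) ->
  (forall z, (y <= z)%O -> pair_ok z) ->
  G y -> covers y p -> (p <= t)%O -> G p.
Proof.
move=> fG Gt tmax; elim/(@finord_ind_down _ L): y p => y IH p ok Gy yp pt.
have yt : (y < t)%O by apply: lt_le_trans pt; case: yp.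
have [y' yy' Gy'] := face_ascent fG Gy Gt (cost_lt yt).
have [<-//|/eqP ne] := eqVneq y' p.
have [Q [fQ plQ Qy [Qy' Qp] Qle]] := ok y (lexx _) y' p yy' yp ne.
have [s Qs smax] := face_sink fQ Qy.
have y's : (y' < s)%O.
  rewrite lt_neqAle smax // andbT; apply/eqP => e.
  by apply: ne; symmetry; apply: (covers_le_eq yp yy'); rewrite e smax.
have [p' y'p' Qp'] := face_ascent fQ Qy' Qs (cost_lt y's).
have y_y' : (y < y')%O by case: yy'.
have Gp' : G p'.
  apply: (IH y') => // [z yz|]; first by apply: ok; apply: le_trans (ltW y_y') yz.
  by apply: le_trans (Qle _ Qp') _; rewrite leUx pt tmax.
(* Both [G] and [Q] contain [y'] and its two neighbours [y] and [p'], so [G] contains all of [Q],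
   and in particular [p]. *)
case: plQ => sub _.
apply: (sub y' y p') => //; [by right|by left|].
by move=> e; have := lt_trans y_y' (proj1 y'p'); rewrite e ltxx.
Qed.

(** Along a chain of covers from [y] up to [w] every element is below [t], so [stay] applies at each
    step. *)
Let stay_le G t y w : isface G -> G t -> (forall z, G z -> (z <= t)%O) ->
  (forall z, (y <= z)%O -> pair_ok z) ->
  G y -> (y <= w)%O -> (w <= t)%O -> G w.
Proof.
move=> fG Gt tmax; elim/(@finord_ind_down _ L): y => y IH ok Gy.
rewrite le_eqVlt => /orP[/eqP<-//|yw wt].
have [z yz zw] := exists_cover_above yw.
have y_z : (y < z)%O by case: yz.
apply: (IH z) => // [x zx|].
  by apply: ok; apply: le_trans (ltW y_z) zx.
by apply: (stay fG Gt tmax ok Gy yz); apply: le_trans wt.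
Qed.

(* The paths from [p] and [q] to their join stay in [Q]; unless that join is the
   sink of the polygon [Q], it would have three neighbours in [Q]. *)
Let pair_okP x : pair_ok x.
Proof.
elim/(@finord_ind_down _ L): x => x IH p q xp xq pq.
have [Q [fQ plQ Qx Qp Qq]] := face_pair xp xq pq.
exists Q; split => //.
have [t Qt tmax] := face_sink fQ Qx.
set w := Order.join p q.
have wt : (w <= t)%O by rewrite leUx !tmax.
have x_p : (x < p)%O by case: xp.
have x_q : (x < q)%O by case: xq.
have okp z : (p <= z)%O -> pair_ok z by move=> pz; apply: IH; apply: lt_le_trans pz.
have okq z : (q <= z)%O -> pair_ok z by move=> pz; apply: IH; apply: lt_le_trans pz.
have pw : (p < w)%O.
  rewrite lt_neqAle leUl andbT; apply/eqP => e.
  by apply: pq; symmetry; apply: (covers_le_eq xq xp); rewrite e leUr.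
have qw : (q < w)%O.
  rewrite lt_neqAle leUr andbT; apply/eqP => e.
  by apply: pq; apply: (covers_le_eq xp xq); rewrite e leUl.
have Qw : Q w by apply: (stay_le fQ Qt tmax okp Qp (ltW pw) wt).
have [q1 q1w pq1] := exists_cover_below pw.
have [q2 q2w qq2] := exists_cover_below qw.
have q1_w : (q1 < w)%O by case: q1w.
have q2_w : (q2 < w)%O by case: q2w.
have Qq1 : Q q1.
  by apply: (stay_le fQ Qt tmax okp Qp pq1); apply: le_trans wt; apply: ltW.
have Qq2 : Q q2.
  by apply: (stay_le fQ Qt tmax okq Qq qq2); apply: le_trans wt; apply: ltW.
suff -> : w = t by [].
apply/eqP; move: wt; rewrite le_eqVlt => /orP[//|wt].
have [e we Qe] := face_ascent fQ Qw Qt (cost_lt wt).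
have w_e : (w < e)%O by case: we.
case: plQ => _ /(_ w q1 q2 e) []//; [by right|by right|by left| | |].
(* If the two lower covers of [w] coincided, they would be an upper bound of [p] and [q] strictly
   below their join. *)
- move=> e12; suff : (w <= q1)%O by rewrite lt_geF.
  by rewrite leUx pq1 e12.
- by move=> ee; move: (lt_trans q1_w w_e); rewrite ee ltxx.
- by move=> ee; move: (lt_trans q2_w w_e); rewrite ee ltxx.
Qed.

(** The element [t] is the join of [S] and [x], given only by its minimality. It is below the sink
    of the face spanned by [S]; if [a] were below [t], then [stay] would put [a] into that face,
    whose only covers of [x] are those in [S]. *)
Lemma cover_not_le_join x S a t : (forall z, z \in S -> covers x z) ->
  covers x a -> a \notin S ->
  (forall y, (x <= y)%O -> (forall z, z \in S -> (z <= y)%O) -> (t <= y)%O) ->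
  ~~ (a <= t)%O.
Proof.
move=> xS xa aS tmin; apply/negP => at_.
have [G [fG Gx GS Gcov]] := face_span xS.
have [s Gs smax] := face_sink fG Gx.
have ts : (t <= s)%O by apply: tmin => [|z zS]; apply: smax => //; exact: GS.
move/negP: aS; apply; apply: Gcov => //.
by apply: (stay fG Gs smax _ Gx xa (le_trans at_ ts)) => z _; exact: pair_okP.
Qed.

End FaceSystem.

(** * Polyhedral cones *)

Section Cones.
Variables (R : realType) (d : nat).
Implicit Types (a b g h x y : 'rV[R]_d) (s : seq 'rV[R]_d).

Lemma dotpC a x : dotp a x = dotp x a.
Proof. by apply: eq_bigr => i _; rewrite mulrC. Qed.

Lemma dotpDr a x y : dotp a (x + y) = dotp a x + dotp a y.
Proof. by rewrite -big_split; apply: eq_bigr => i _; rewrite mxE mulrDr. Qed.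

Lemma dotpZr a (k : R) x : dotp a (k *: x) = k * dotp a x.
Proof. by rewrite mulr_sumr; apply: eq_bigr => i _; rewrite mxE mulrCA. Qed.

Lemma dotp0r a : dotp a 0 = 0.
Proof. by rewrite /dotp big1 // => i _; rewrite mxE mulr0. Qed.

Lemma dotpNr a x : dotp a (- x) = - dotp a x.
Proof. by rewrite -scaleN1r dotpZr mulN1r. Qed.

Lemma dotpBr a x y : dotp a (x - y) = dotp a x - dotp a y.
Proof. by rewrite dotpDr dotpNr. Qed.

Lemma dotpDl a b x : dotp (a + b) x = dotp a x + dotp b x.
Proof. by rewrite dotpC dotpDr !(dotpC x). Qed.

Lemma dotpZl (k : R) a x : dotp (k *: a) x = k * dotp a x.
Proof. by rewrite dotpC dotpZr dotpC. Qed.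

Lemma dotp0l a : dotp 0 a = 0.
Proof. by rewrite dotpC dotp0r. Qed.

Lemma dotp_sumr a n (F : 'I_n -> 'rV[R]_d) :
  dotp a (\sum_i F i) = \sum_i dotp a (F i).
Proof. exact: (big_morph _ (dotpDr a) (dotp0r a)). Qed.

Lemma dotp_gt0 x : x != 0 -> 0 < dotp x x.
Proof.
move=> x0; rewrite lt_neqAle eq_sym sumr_ge0 ?andbT => [|i _]; last first.
  by rewrite -expr2 sqr_ge0.
apply: contra x0 => /eqP xx0; apply/eqP/rowP => i; rewrite mxE.
have /eqP := psumr_eq0P (fun i _ => sqr_ge0 (x 0 i)) xx0 (i := i) isT.
by rewrite mulf_eq0 orbb => /eqP.
Qed.

(** The cone of nonnegative combinations of [s], with one coefficient peeled off per generator so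
    that proofs follow the list. *)
Fixpoint incone s b : Prop :=
  if s is a :: s' then exists2 t : R, 0 <= t & incone s' (b - t *: a) else b = 0.

Lemma incone_ind s (K : 'rV[R]_d -> Prop) :
  K 0 -> (forall (t : R) a y, 0 <= t -> a \in s -> K y -> K (t *: a + y)) ->
  forall x, incone s x -> K x.
Proof.
move=> K0; elim: s => [|a s IH] KD x /=; first by move->.
move=> [t t0 /IH Kx].
rewrite -(subrK (t *: a) x) addrC; apply: (KD); rewrite ?mem_head //.
by apply: Kx => // r b y r0 bs; apply: KD; rewrite // inE bs orbT.
Qed.

Lemma incone0 s : incone s 0.
Proof. by elim: s => //= a s IH; exists 0; rewrite // scale0r subr0. Qed.

Lemma inconeD s x y : incone s x -> incone s y -> incone s (x + y).
Proof.
elim: s x y => [|a s IH] x y /=; first by move=> -> ->; rewrite addr0.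
move=> [t t0 xt] [r r0 yr].
by exists (t + r); rewrite ?addr_ge0 // scalerDl opprD addrACA; apply: IH.
Qed.

Lemma inconeZ s (k : R) x : 0 <= k -> incone s x -> incone s (k *: x).
Proof.
move=> k0; elim: s x => [|a s IH] x /=; first by move=> ->; rewrite scaler0.
move=> [t t0 xt].
by exists (k * t); rewrite ?mulr_ge0 // -scalerA -scalerBr; apply: IH.
Qed.

Lemma incone_mem s a : a \in s -> incone s a.
Proof.
elim: s => //= b s IH; rewrite inE => /orP[/eqP->|/IH sa].
  by exists 1; rewrite // scale1r subrr; apply: incone0.
by exists 0; rewrite // scale0r subr0.
Qed.

Lemma incone_trans s s' x :
  {in s, forall a, incone s' a} -> incone s x -> incone s' x.
Proof.
move=> ss'; apply: incone_ind x => [|t a y t0 /ss' as' ys']; first exact: incone0.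
by apply: inconeD => //; apply: inconeZ.
Qed.

Lemma incone_sub s s' x : {subset s <= s'} -> incone s x -> incone s' x.
Proof. by move=> ss'; apply: incone_trans => a /ss'/incone_mem. Qed.

(** Lifts membership in a cone projected along [g] back to the original generators; the multiples of
    [g] collected on the way are nonnegative because [k] is. *)
Lemma incone_shear s (k : 'rV[R]_d -> R) g b : {in s, forall a, 0 <= k a} ->
  incone [seq a + k a *: g | a <- s] b ->
  exists2 t, 0 <= t & incone s (b - t *: g).
Proof.
elim: s b => [|a s IH] b k0 /=; first by move=> ->; exists 0; rewrite // scale0r subr0.
move=> [t t0] /IH[r rs|r r0 br]; first by apply: k0; rewrite inE rs orbT.
exists (r + t * k a); first by rewrite addr_ge0 // mulr_ge0 // k0 ?mem_head.
exists t => //; congr (incone s _): br.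
by apply/rowP => i; rewrite !mxE; ring.
Qed.

(* If [y] separates [b] from the cone of [s] but not from that of [g :: s],
   both are projected along [g] to the hyperplane orthogonal to [y]. *)
Lemma farkas s b : incone s b \/
  exists2 y, {in s, forall a, dotp y a <= 0} & 0 < dotp y b.
Proof.
move: {2}(size s) (erefl (size s)) => n; elim: n s b => [|n IH] [|g s] b //=.
  move=> _; have [->|/dotp_gt0] := eqVneq b 0; [by left|by right; exists b].
move=> [sn]; have [bs|[y ys yb]] := IH s b sn.
  by left; exists 0; rewrite // scale0r subr0.
have [yg|yg] := leP (dotp y g) 0.
  by right; exists y => // a; rewrite inE => /orP[/eqP->//|/ys].
pose k a : R := - (dotp y a / dotp y g).
have k0 : {in s, forall a, 0 <= k a}.
  by move=> a /ys ya; rewrite oppr_ge0 pmulr_lle0 ?invr_gt0.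
have [|/(incone_shear k0)[t t0 bt]|[z zs zb]] :=
  IH [seq a + k a *: g | a <- s] (b + k b *: g).
- by rewrite size_map.
- left; exists (t - k b).
    by rewrite addr_ge0 // opprK ltW // divr_gt0.
  by congr (incone s _): bt; apply/rowP => i; rewrite !mxE; ring.
(* The pullback of [z] under the projection along [g]; it vanishes on [g]. *)
- pose w := z - (dotp z g / dotp y g) *: y.
  have wE a : dotp w a = dotp z (a + k a *: g).
    rewrite /w dotpDl -scaleNr dotpZl dotpDr dotpZr /k.
    by ring.
  right; exists w; last by rewrite wE.
  move=> a; rewrite inE => /orP[/eqP->|sa]; rewrite wE.
    by rewrite /k divff ?gt_eqF // scaleN1r subrr dotp0r.
  by apply: zs; apply/mapP; exists a.
Qed.

Lemma irredundant_generators s : exists s0, [/\ {subset s0 <= s},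
  {in s, forall a, incone s0 a} & {in s0, forall g, ~ incone (rem g s0) g}].
Proof.
move: {2}(size s) (leqnn (size s)) => n; elim: n s => [|n IH] s.
  by rewrite leqn0 size_eq0 => /eqP->; exists [::].
move=> sn; have [[g gs gc]|irr] :=
  pselect (exists2 g, g \in s & incone (rem g s) g); last first.
  exists s; split => // [a /incone_mem//|g gs gc].
  by apply: irr; exists g.
have [|s0 [s0s ss0 irr]] := IH (rem g s).
  by rewrite size_rem // -subn1 leq_subLR.
exists s0; split => // [a /s0s/mem_rem//|a].
rewrite (perm_mem (perm_to_rem gs)) inE => /orP[/eqP->|/ss0//].
exact: incone_trans gc.
Qed.

(* For an irredundant generating set, the images of the other generators modulo
   [g] still span a pointed cone, so some functional vanishing on [g] is negative
   on all of them. *)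
Lemma exposed_generators s h : {in s, forall a, dotp h a < 0} ->
  exists s0, [/\ {subset s0 <= s}, {in s, forall a, incone s0 a}
   & {in s0, forall g, exists a, dotp a g = 0 /\ forall m, incone s m ->
       dotp a m <= 0 /\ (dotp a m = 0 -> exists2 t, 0 <= t & m = t *: g)}].
Proof.
move=> hs; have [s0 [s0s ss0 irr]] := irredundant_generators s.
exists s0; split => // g gs0; set r := rem g s0.
have rs0 : {subset r <= s0} by move=> m /mem_rem.
have one m : m \in r -> exists a,
    [/\ dotp a g = 0, {in r, forall m', dotp a m' <= 0} & dotp a m < 0].
  (* Including both [g] and [- g] forces a separating functional to vanish on [g]. *)
  move=> mr; have [[t t0 [u u0 mc]]|[y yr ym]] := farkas [:: g, - g & r] (- m).
    have {mc}: incone r ((u - t) *: g - m).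
      by congr (incone r _): mc; apply/rowP => i; rewrite !mxE; ring.
    (* A nonpositive coefficient of [g] contradicts the negativity of [h] on the generators; a
       positive one puts [g] into the cone of the others, against irredundancy. *)
    have [ut|ut] := lerP (u - t) 0.
      move=> mc; suff : dotp h ((u - t) *: g - m) <= 0.
        rewrite dotpBr dotpZr leNgt => /negP[]; rewrite subr_gt0.
        apply: (@lt_le_trans _ _ 0); first exact/hs/s0s/rs0.
        by rewrite mulr_le0 // ltW // hs // s0s.
      move: mc; apply: (incone_ind (K := fun x => dotp h x <= 0)).
        by rewrite dotp0r.
      move=> t' a y t'0 ar hy.
      rewrite dotpDr dotpZr ler_wnDr // mulr_ge0_le0 // ltW //.
      exact/hs/s0s/rs0.
    move=> mc; case: (irr g gs0).
    have gE : g = (u - t)^-1 *: (((u - t) *: g - m) + m).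
      by rewrite subrK scalerA mulVf ?scale1r // gt_eqF.
    rewrite [X in incone _ X]gE; apply: inconeZ; first by rewrite invr_ge0 ltW.
    by apply: inconeD => //; apply: incone_mem.
  exists y; split.
  - apply/eqP; rewrite eq_le yr ?mem_head //= -oppr_le0 -dotpNr.
    by apply: yr; rewrite !inE eqxx orbT.
  - by move=> a ar; apply: yr; rewrite !inE ar !orbT.
  - by move: ym; rewrite dotpNr oppr_gt0.
(* Summing the functionals found for the single [m] makes the inequality strict on all of [r] at
   once. *)
have [a [ag ar]] : exists a, dotp a g = 0 /\ {in r, forall m, dotp a m < 0}.
  suff [a [ag _ ar]] : exists a, [/\ dotp a g = 0,
      {in r, forall m, dotp a m <= 0} & {in r, forall m, dotp a m < 0}].
    by exists a.
  have : {subset r <= r} by [].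
  elim: {1 4}r => [|m l IH] lr.
    by exists 0; split=> [|m _|//]; rewrite dotp0l.
  have [|a [ag ar al]] := IH; first by move=> x xl; apply: lr; rewrite inE xl orbT.
  have [b [bg br bm]] := one m (lr m (mem_head _ _)).
  exists (a + b); split.
  - by rewrite dotpDl ag bg addr0.
  - by move=> x xr; rewrite dotpDl ler_wnDr ?ar ?br.
  - move=> x; rewrite inE dotpDl => /orP[/eqP->|xl].
      by rewrite -[ltRHS]addr0 ler_ltD // ar // lr // mem_head.
    by rewrite -[ltRHS]addr0 ltr_leD // ?al // br // lr // inE xl orbT.
exists a; split => // m ms.
have : incone s0 m by apply: incone_trans ms.
apply: (incone_ind (K := fun m => dotp a m <= 0 /\
  (dotp a m = 0 -> exists2 t, 0 <= t & m = t *: g))) => [|t x y t0].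
  by rewrite dotp0r; split => // _; exists 0; rewrite // scale0r.
rewrite (perm_mem (perm_to_rem gs0)) inE dotpDr dotpZr.
move=> /orP[/eqP->|xr] [yle yeq].
  rewrite ag mulr0 add0r; split => // /yeq[u u0 ->].
  by exists (t + u); rewrite ?addr_ge0 // scalerDl.
have tx : t * dotp a x <= 0 by rewrite mulr_ge0_le0 // ltW // ar.
split; first by rewrite ler_wnDr.
move=> /eqP; rewrite naddr_eq0 // => /andP[]; rewrite mulf_eq0.
rewrite (lt_eqF (ar _ xr)) orbF => /eqP -> /eqP/yeq[u u0 ->].
by exists u; rewrite // scale0r add0r.
Qed.

End Cones.

(** * Edges of polytopes *)

Section PolytopeEdges.
Variables (R : realType) (d : nat).
Implicit Types (A F P : set 'rV[R]_d) (a c g p q u v w x y : 'rV[R]_d).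

Lemma convex_hull_sub A : A `<=` convex_hull A.
Proof.
move=> x Ax; exists 1%N, (fun=> x), (fun=> 1); split => //.
  by rewrite big_ord1.
by rewrite big_ord1 scale1r.
Qed.

Lemma affine_hull_sub A : A `<=` affine_hull A.
Proof.
move=> x Ax; exists 1%N, (fun=> x), (fun=> 1); split => //.
  by rewrite big_ord1.
by rewrite big_ord1 scale1r.
Qed.

Lemma affine_comb_sub n (l : 'I_n -> R) (f : 'I_n -> 'rV[R]_d) u :
  \sum_i l i = 1 -> \sum_i l i *: f i - u = \sum_i l i *: (f i - u).
Proof.
move=> l1; rewrite -[X in _ - X]scale1r -l1 scaler_suml -sumrB.
by apply: eq_bigr => i _; rewrite scalerBr.
Qed.

Lemma segmentP u v x :
  convex_hull [set u; v] x <-> exists2 t : R, 0 <= t <= 1 & x = u + t *: (v - u).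
Proof.
split=> [[n [f [l [fuv l0 l1 ->]]]]|[t /andP[t0 t1] ->]].
  exists (\sum_(i | f i == v) l i).
    rewrite sumr_ge0 //= -l1 [leRHS](bigID (fun i => f i == v)) /= lerDl.
    by rewrite sumr_ge0.
  apply: (addIr (- u)); rewrite affine_comb_sub // [RHS]addrC addKr.
  rewrite (bigID (fun i => f i == v)) /= scaler_suml [X in _ + X]big1 ?addr0.
    by apply: eq_bigr => i /eqP->.
  by move=> i /eqP fv; case: (fuv i) => // ->; rewrite subrr scaler0.
exists 2%N, (fun i => if i == ord0 then u else v),
  (fun i => if i == ord0 then 1 - t else t); split.
- by move=> i; case: ifP => _; [left|right].
- by move=> i; case: ifP; rewrite ?subr_ge0.
- by rewrite !big_ord_recl big_ord0 /= addr0 subrK.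
- rewrite !big_ord_recl big_ord0 /=.
  by apply/rowP => i; rewrite !mxE; ring.
Qed.

Lemma segmentC u v : convex_hull [set u; v] = convex_hull [set v; u].
Proof. by rewrite setUC. Qed.

Lemma segment_has_dim1 u v : u != v -> has_dim (convex_hull [set u; v]) 1.
Proof.
move=> uv; exists u, <[v - u]>%VS; split.
  by rewrite dim_vline subr_eq0 eq_sym uv.
apply/seteqP; split => x /=.
  move=> [n [f [l [fuv l1 ->]]]]; rewrite affine_comb_sub //.
  apply: memv_suml => i _; apply: memvZ.
  have /segmentP[t _ ->] := fuv i.
  by rewrite addrC addKr; apply: memvZ; exact: memv_line.
move=> /vlineP[k xk].
exists 2%N, (fun i => if i == ord0 then u else v),
  (fun i => if i == ord0 then 1 - k else k); split.
- by move=> i; apply: convex_hull_sub; case: ifP => _; [left|right].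
- by rewrite !big_ord_recl big_ord0 /= addr0 subrK.
- rewrite !big_ord_recl big_ord0 /=.
  rewrite -[LHS](subrK u) xk.
  by apply/rowP => i; rewrite !mxE; ring.
Qed.

(** Moves the base point of the affine hull to any point [x] of [F]. The direction space [U] is
    least because every point of [x + U] is an affine combination of points of [F]. *)
Lemma has_dim_direction F k x : has_dim F k -> F x ->
  exists U : {vspace 'rV[R]_d}, [/\ \dim U = k, forall y, F y -> y - x \in U
    & forall K : {vspace 'rV[R]_d}, (forall y, F y -> y - x \in K) -> (U <= K)%VS].
Proof.
move=> [x0 [U [dU hU]]] Fx; exists U.
have inU y : F y -> y - x0 \in U.
  by move=> Fy; have : affine_hull F y := affine_hull_sub Fy; rewrite hU.
have FU y : F y -> y - x \in U.
  move=> Fy; have -> : y - x = (y - x0) - (x - x0) by rewrite opprB addrA subrK.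
  by rewrite rpredB ?inU.
split => // K FK; apply/subvP => u uU.
have : affine_hull F (x + u).
  by rewrite hU /= addrAC rpredD ?inU.
move=> [n [f [l [Ff l1 xu]]]].
have -> : u = \sum_i l i *: f i - x by rewrite -xu addrC addKr.
by rewrite affine_comb_sub // memv_suml // => i _; apply: memvZ; apply: FK.
Qed.

Lemma vertexP P v : vertex P v -> P v /\
  exists a, forall x, P x -> dotp a x <= dotp a v /\ (dotp a x = dotp a v -> x = v).
Proof.
move=> [a [b [Pb vE]]].
have [Pv av] : [set x | P x /\ dotp a x = b] v by rewrite -vE.
split => //; exists a => x Px; rewrite av; split; first exact: Pb.
by move=> ax; suff : [set v] x by []; rewrite vE.
Qed.

Lemma faceP P F v : face P F -> F v ->
  exists a, forall x, P x -> dotp a x <= dotp a v /\ (F x <-> dotp a x = dotp a v).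
Proof.
move=> [a [b [Pb ->]]] [Pv av]; exists a => x Px; rewrite av; split; first exact: Pb.
by split => // -[].
Qed.

Lemma face_sub P F : face P F -> F `<=` P.
Proof. by move=> [a [b [_ ->]]] x []. Qed.

Lemma vertex_in_segment P u v w : P u -> P v -> vertex P w ->
  convex_hull [set u; v] w -> w = u \/ w = v.
Proof.
move=> Pu Pv /vertexP[_ [a aw]] /segmentP[t /andP[t0 t1] wE].
have [au uE] := aw _ Pu; have [av vE] := aw _ Pv.
have := wE => /(congr1 (dotp a)); rewrite dotpDr dotpZr dotpBr => awE.
have [t_0|t_0] := eqVneq t 0; first by left; rewrite wE t_0 scale0r addr0.
right; symmetry; apply: vE; apply/eqP; rewrite eq_le av /=.
have : 0 < t by rewrite lt_neqAle eq_sym t_0.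
move=> tp; rewrite -subr_le0 -(pmulr_rle0 _ tp); nra.
Qed.

Lemma scale_dominates (T : eqType) (s : seq T) (f k : T -> R) :
  {in s, forall i, f i < 0} -> exists2 N, 0 <= N & {in s, forall i, N * f i + k i < 0}.
Proof.
elim: s => [|p s IH] fs; first by exists 0.
have [|N N0 Ns] := IH; first by move=> x xs; apply: fs; rewrite inE xs orbT.
have fp := fs p (mem_head _ _).
exists (Num.max N ((`|k p| + 1) / - f p)); first by rewrite le_max N0.
move=> x; rewrite inE => /orP[/eqP->|xs].
  have : `|k p| + 1 <= Num.max N ((`|k p| + 1) / - f p) * - f p.
    by rewrite -ler_pdivrMr ?oppr_gt0 // le_max lexx orbT.
  have := ler_norm (k p); lra.
have fx : f x < 0 by apply: fs; rewrite inE xs orbT.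
apply: le_lt_trans (Ns x xs); rewrite lerD2r ler_wnM2r ?le_max ?lexx //.
exact: ltW.
Qed.

Lemma seq_argmax (T : eqType) (s : seq T) (f : T -> R) (p : T) : p \in s ->
  exists2 q : T, q \in s & {in s, forall i, f i <= f q}.
Proof.
elim: s p => // p s IH _ _; case: s IH => [_|r s IH].
  by exists p; rewrite ?mem_head // => x; rewrite inE => /eqP->.
have [q qs qmax] := IH r (mem_head _ _).
have [pq|qp] := leP (f p) (f q).
  by exists q; rewrite 1?inE ?qs ?orbT // => x; rewrite inE => /orP[/eqP->|/qmax].
exists p; rewrite ?mem_head // => x; rewrite inE => /orP[/eqP->//|/qmax xq].
exact: le_trans xq (ltW qp).
Qed.

Lemma hull_dotp_le (s : seq 'rV[R]_d) a (b : R) x :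
  {in s, forall p, dotp a p <= b} -> convex_hull [set` s] x -> dotp a x <= b.
Proof.
move=> sb [n [f [l [fs l0 l1 ->]]]]; rewrite dotp_sumr -[b]mul1r -l1 mulr_suml.
by apply: ler_sum => i _; rewrite dotpZr ler_wpM2l //; apply: sb; exact: fs.
Qed.

Lemma vertex_of_max (s : seq 'rV[R]_d) a q : q \in s ->
  {in s, forall p, p != q -> dotp a p < dotp a q} -> vertex (convex_hull [set` s]) q.
Proof.
move=> qs qmax; exists a, (dotp a q); split.
  move=> x; apply: hull_dotp_le => p ps.
  by have [->//|/(qmax p ps)/ltW] := eqVneq p q.
apply/seteqP; split => [x ->|x [[n [f [l [fs l0 l1 ->]]]]]] /=.
  by split=> //; apply: convex_hull_sub.
move=> /eqP; rewrite -subr_eq0 -dotpBr affine_comb_sub // dotp_sumr => /eqP aq.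
apply/eqP; rewrite -subr_eq0 affine_comb_sub //; apply/eqP; apply: big1 => i _.
have [->|fq] := eqVneq (f i) q; first by rewrite subrr scaler0.
have le0 j : true -> 0 <= - dotp a (l j *: (f j - q)).
  move=> _; rewrite dotpZr dotpBr oppr_ge0 mulr_ge0_le0 // subr_le0.
  by have [->//|/(qmax _ (fs j))/ltW] := eqVneq (f j) q.
have : \sum_j - dotp a (l j *: (f j - q)) = 0 by rewrite sumrN aq oppr0.
move/(psumr_eq0P le0)/(_ i isT)/eqP; rewrite oppr_eq0 dotpZr mulf_eq0.
rewrite dotpBr subr_eq0 (lt_eqF (qmax _ (fs i) fq)) orbF => /eqP->.
by rewrite scale0r.
Qed.

Lemma hull_incone (s : seq 'rV[R]_d) v x : convex_hull [set` s] x ->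
  incone [seq p - v | p <- s & p != v] (x - v).
Proof.
move=> [n [f [l [fs l0 l1 ->]]]]; rewrite affine_comb_sub //.
apply: (big_ind (incone _)) => [||i _]; [exact: incone0|exact: inconeD|].
apply: inconeZ => //; have [->|fv] := eqVneq (f i) v.
  by rewrite subrr; exact: incone0.
apply: incone_mem; apply/mapP; exists (f i) => //.
by rewrite mem_filter fv; exact: fs.
Qed.

(* The far endpoint [q] is exposed by the perturbation [N *: a + g], [N] large. *)
Lemma exposed_edge (s : seq 'rV[R]_d) v a p0 g :
  let P := convex_hull [set` s] in g = p0 - v ->
  P v -> p0 \in s -> p0 != v -> dotp a g = 0 ->
  (forall x, P x -> dotp a (x - v) <= 0 /\
     (dotp a (x - v) = 0 -> exists2 t : R, 0 <= t & x - v = t *: g)) ->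
  exists q, [/\ vertex P q, q != v, edge P (convex_hull [set v; q])
    & exists2 t : R, 0 <= t & g = t *: (q - v)].
Proof.
move=> P gE Pv p0s p0v ag aP.
have sP p : p \in s -> P p by move=> ps; exact: convex_hull_sub.
have gg : 0 < dotp g g by apply: dotp_gt0; rewrite gE subr_eq0.
(* These are the given points on the exposed ray from [v]; the one farthest in the direction [g] is
   the other end of the edge. *)
pose S := [seq p <- s | dotp a (p - v) == 0].
have p0S : p0 \in S by rewrite mem_filter -gE ag eqxx.
have [q qS qmax] := seq_argmax (dotp g) p0S.
move: (qS); rewrite mem_filter => /andP[/eqP aq qs].
have [_ /(_ aq)[r r0 qr]] := aP q (sP q qs).
have r1 : 1 <= r.
  have := qmax _ p0S; rewrite -(subrK v p0) -(subrK v q) -gE qr !dotpDr lerD2r dotpZr.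
  by rewrite -[X in X <= _]mul1r ler_pM2r.
have rgt0 : 0 < r by apply: lt_le_trans r1.
have [|N N0 Nlt] := @scale_dominates _ [seq p <- s | dotp a (p - v) < 0]
  (fun p => dotp a (p - v)) (fun p => dotp g (p - q)).
  by move=> p; rewrite mem_filter => /andP[].
pose e := N *: a + g.
have eE x : dotp e x - dotp e q = N * dotp a (x - v) + dotp g (x - q).
  have aqv : dotp a q = dotp a v by apply/eqP; rewrite -subr_eq0 -dotpBr aq.
  by rewrite /e !dotpDl !dotpZl !dotpBr aqv; ring.
have emax : {in s, forall p, p != q -> dotp e p < dotp e q}.
  move=> p ps pq; rewrite -subr_lt0 eE.
  have [ap0 apE] := aP p (sP p ps).
  move: ap0; rewrite le_eqVlt => /orP[/eqP ap|ap]; last first.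
    by apply: Nlt; rewrite mem_filter ap.
  have [t t0 pt] := apE ap.
  have pS : p \in S by rewrite mem_filter ap eqxx.
  rewrite ap mulr0 add0r dotpBr subr_lt0 lt_neqAle qmax // andbT.
  apply: contra pq => /eqP; rewrite -(subrK v p) -(subrK v q) pt qr !dotpDr => /addIr.
  by rewrite !dotpZr => /(mulIf (lt0r_neq0 gg)) ->.
have eP x : P x -> dotp e x <= dotp e q.
  apply: hull_dotp_le => p ps.
  by have [->//|/(emax p ps)/ltW] := eqVneq p q.
have qv : q != v.
  rewrite -subr_eq0 qr scaler_eq0 negb_or (gt_eqF rgt0) /= gE.
  by rewrite subr_eq0.
exists q; split => //.
- exact: vertex_of_max emax.
- split; last by apply: segment_has_dim1; rewrite eq_sym.
  exists a, (dotp a v); split.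
    by move=> x /aP[+ _]; rewrite dotpBr subr_le0.
  apply/seteqP; split => x /=.
    move=> /segmentP[t /andP[t0 t1] xt].
    have ax : dotp a x = dotp a v by rewrite xt dotpDr dotpZr aq mulr0 addr0.
    split => //.
    have [n [f [l [fs l0 l1 vE]]]] := Pv.
    (* A combination representing [v] is scaled by [1 - t], and [q] is added to it as one further
       term with coefficient [t]. *)
    exists n.+1, (fun i => if unlift ord0 i is Some j then f j else q),
       (fun i => if unlift ord0 i is Some j then (1 - t) * l j else t); split.
    + by move=> i; case: unliftP => [j _|_]; [exact: fs|].
    + by move=> i; case: unliftP => [j _|_] //; rewrite mulr_ge0 // subr_ge0.
    + rewrite big_ord_recl unlift_none; under eq_bigr do rewrite liftK.
      by rewrite -mulr_sumr l1 mulr1 addrC subrK.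
    + rewrite big_ord_recl unlift_none; under eq_bigr do rewrite liftK -scalerA.
      rewrite -scaler_sumr -vE xt.
      by apply/rowP => i; rewrite !mxE; ring.
  move=> [Px ax].
  have [_ ] := aP x Px; rewrite dotpBr ax subrr => /(_ erefl)[t t0 xt].
  apply/segmentP; exists (t / r).
    rewrite divr_ge0 //= ler_pdivrMr // mul1r.
    have := eP x Px; rewrite -subr_le0 eE dotpBr ax subrr mulr0 add0r.
    rewrite dotpBr subr_le0 -(subrK v x) -(subrK v q) xt qr !dotpDr lerD2r !dotpZr.
    by rewrite ler_pM2r.
  by rewrite qr scalerA divfK ?gt_eqF // -xt addrC subrK.
- exists r^-1; first by rewrite invr_ge0.
  by rewrite qr scalerA mulVf ?scale1r // gt_eqF.
Qed.

(** A polytope lies in the cone spanned at [v] by its edges. The functional exposing [v] is negative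
    on all the generators [p - v], so these can be thinned out to exposed rays, and each such ray
    carries an edge. *)
Lemma vertex_cone P v : polytope P -> vertex P v ->
  exists W : seq 'rV[R]_d,
    {in W, forall w, [/\ vertex P w, w != v & edge P (convex_hull [set v; w])]} /\
    (forall x, P x -> incone [seq w - v | w <- W] (x - v)).
Proof.
move=> [s ->] /vertexP[Pv [h hv]].
pose M := [seq p - v | p <- s & p != v].
have [|M0 [M0M MM0 M0e]] := @exposed_generators _ _ M h.
  move=> m /mapP[p]; rewrite mem_filter => /andP[pv ps] ->.
  rewrite dotpBr subr_lt0 lt_neqAle.
  have [-> pE] := hv p (convex_hull_sub ps); rewrite andbT.
  by apply: contra pv => /eqP/pE->.
have {M0e} M0e g : g \in M0 -> exists q, [/\ vertex (convex_hull [set` s]) q, q != v,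
    edge (convex_hull [set` s]) (convex_hull [set v; q])
    & exists2 t : R, 0 <= t & g = t *: (q - v)].
  move=> gM0; have [a [ag aM]] := M0e g gM0.
  have /mapP[p0] := M0M g gM0; rewrite mem_filter => /andP[p0v p0s] gE.
  apply: (exposed_edge gE _ _ _ ag) => // x Px.
  exact/aM/hull_incone.
suff [W [Wok WM]] : exists W : seq 'rV[R]_d,
   {in W, forall w, [/\ vertex (convex_hull [set` s]) w, w != v
     & edge (convex_hull [set` s]) (convex_hull [set v; w])]} /\
   {in M0, forall g, incone [seq w - v | w <- W] g}.
  exists W; split => // x /(hull_incone v); apply: incone_trans => m /MM0.
  exact: incone_trans.
elim: (M0) M0e => [|g l IH] le; first by exists [::]; split.
have [|W [Wok Wl]] := IH; first by move=> x xl; apply: le; rewrite inE xl orbT.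
have [q [vq qv eq_ [t t0 gE]]] := le g (mem_head _ _).
exists (q :: W); split=> x; rewrite inE => /orP[/eqP->|]; first by split.
- exact: Wok.
- by rewrite gE; apply: inconeZ => //; apply: incone_mem; rewrite mem_head.
- by move/Wl; apply: incone_sub => y; rewrite inE orbC => ->.
Qed.

End PolytopeEdges.

(** * Faces of a simple polytope through their vertices *)

Section SimplePolytopeLattice.
Variables (R : realType) (d : nat) (P : set 'rV[R]_d) (c : 'rV[R]_d).
Variables (disp : Order.disp_t) (L : finPOrderType disp) (vtx : L -> 'rV[R]_d).
Hypothesis simpleP : simple_polytope P.
Hypothesis genericP : generic_cost P c.
Hypothesis hasseP : skeleton_is_hasse_diagram P c vtx.
Implicit Types (x y z : L) (l : seq L) (F : set 'rV[R]_d).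

Let vtx_inj : injective vtx. Proof. by case: hasseP. Qed.

Let vertex_vtx x : vertex P (vtx x).
Proof.
case: hasseP => _ rg _; have : range vtx (vtx x) by exists x.
by rewrite rg.
Qed.

Let P_vtx x : P (vtx x). Proof. by have [] := vertexP (vertex_vtx x). Qed.

Let vertex_ex v : vertex P v -> exists x, v = vtx x.
Proof.
case: hasseP => _ rg _ Pv; suff [x _ <-] : range vtx v by exists x.
by rewrite rg.
Qed.

Let cost x := dotp c (vtx x).

Lemma cost_inj : injective cost.
Proof. by move=> x y /(genericP (vertex_vtx x) (vertex_vtx y))/vtx_inj. Qed.

Lemma cost_covers x y : covers x y -> cost x < cost y.
Proof. by case: hasseP => _ _ arc /arc[]. Qed.

Lemma adjacentP x y : adjacent x y <->
  x <> y /\ edge P (convex_hull [set vtx x; vtx y]).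
Proof.
case: hasseP => _ _ arc; split=> [[xy|yx]|[xy e]].
- split; last by have /arc[] := xy.
  by move=> e; have := cost_covers xy; rewrite e ltxx.
- split; last by rewrite segmentC; have /arc[] := yx.
  by move=> e; have := cost_covers yx; rewrite e ltxx.
have [h|h|h] := ltgtP (cost x) (cost y).
- by left; apply/arc; split.
- by right; apply/arc; split; rewrite // segmentC.
- by case: xy; apply: cost_inj.
Qed.

Let vec x y := vtx y - vtx x.
Let nbs x := [seq y <- enum L | `[< adjacent x y >]].

Let mem_nbs x y : (y \in nbs x) = `[< adjacent x y >].
Proof. by rewrite mem_filter mem_enum andbT. Qed.

Let cone_nbs x p : P p -> incone [seq vec x y | y <- nbs x] (p - vtx x).
Proof.
move=> Pp; have [W [Wok /(_ p Pp)]] := vertex_cone (proj1 simpleP) (vertex_vtx x).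
apply: incone_trans => _ /mapP[w wW ->]; apply: incone_mem.
have [/vertex_ex[y ->] yx e] := Wok w wW.
apply/mapP; exists y => //; rewrite mem_nbs; apply/asboolP/adjacentP.
by split => // xy; rewrite xy eqxx in yx.
Qed.

Let edge_inj x y z : x <> y -> x <> z ->
  convex_hull [set vtx x; vtx y] = convex_hull [set vtx x; vtx z] -> y = z.
Proof.
move=> xy xz e; have : convex_hull [set vtx x; vtx z] (vtx y).
  by rewrite -e; apply: convex_hull_sub; right.
case/(vertex_in_segment (P_vtx x) (P_vtx z) (vertex_vtx y)) => /vtx_inj// yx.
by case: xy.
Qed.

Let simple_face x l : uniq l -> {in l, forall y, adjacent x y} ->
  exists F, [/\ face P F, has_dim F (size l), F (vtx x) & {in l, forall y, F (vtx y)}].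
Proof.
move=> ul ladj.
pose E (i : 'I_(size l)) := convex_hull [set vtx x; vtx (nth x l i)].
have adjE (i : 'I_(size l)) : adjacent x (nth x l i) by apply: ladj; rewrite mem_nth.
have Einj : injective E.
  move=> i j /edge_inj e; apply/val_inj/eqP.
  rewrite -(nth_uniq x (ltn_ord i) (ltn_ord j) ul); apply/eqP; apply: e.
    by have /adjacentP[] := adjE i.
  by have /adjacentP[] := adjE j.
case: (proj2 simpleP _ (vertex_vtx x) _ E Einj).
  move=> i; split; first by have /adjacentP[] := adjE i.
  by apply: convex_hull_sub; left.
move=> F [fF dF Fx EF]; exists F; split => // y yl.
have il : (index y l < size l)%N by rewrite index_mem.
apply: (EF (Ordinal il)); apply: convex_hull_sub; right => /=.
by rewrite nth_index.
Qed.

(* The face spanned by all the edges at [x] has as many dimensions as there are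
   edges, yet lies in the cone of these edges. *)
Let free_nbs x : free [seq vec x y | y <- nbs x].
Proof.
have [||F [fF dF Fx _]] := @simple_face x (nbs x).
- by rewrite filter_uniq // enum_uniq.
- by move=> y; rewrite mem_nbs => /asboolP.
have [U [dU _ Umin]] := has_dim_direction dF Fx.
rewrite /free eqn_leq dim_span size_map -dU dimvS //; apply: Umin => p Fp.
have := cone_nbs x (face_sub fF Fp).
apply: (incone_ind (K := fun v => v \in <<[seq vec x y | y <- nbs x]>>%VS)).
  exact: mem0v.
by move=> t a v _ al vl; rewrite memvD // memvZ // memv_span.
Qed.

Let free_adj x l : uniq l -> {in l, forall y, adjacent x y} ->
  free [seq vec x y | y <- l].
Proof.
move=> ul ladj; apply: (@catl_free _ _ [seq vec x y | y <- nbs x & y \notin l]).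
rewrite -map_cat (perm_free (Y := [seq vec x y | y <- nbs x])) ?free_nbs //.
apply: perm_map; apply: perm_trans (permEl (perm_filterC (mem l) (nbs x))).
rewrite perm_cat2r; apply: uniq_perm => //.
  by rewrite filter_uniq // filter_uniq // enum_uniq.
move=> y; rewrite mem_filter mem_nbs inE; case: (boolP (y \in l)) => //= yl.
by rewrite (asboolT (ladj _ yl)).
Qed.

(** The edge vectors at [x] are linearly independent, so those lying in [F] are at most as many as
    its dimension, and span its direction space when they reach it. *)
Let adj_in_face F k x l : face P F -> has_dim F k -> F (vtx x) -> uniq l ->
    {in l, forall y, adjacent x y} -> {in l, forall y, F (vtx y)} ->
  (size l <= k)%N /\ (size l = k -> forall p, F p ->
    p - vtx x \in <<[seq vec x y | y <- l]>>%VS).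
Proof.
move=> fF dF Fx ul ladj lF.
have [U [<- UF _]] := has_dim_direction dF Fx.
have sU : (<<[seq vec x y | y <- l]>> <= U)%VS.
  by apply/span_subvP => _ /mapP[y yl ->]; apply: UF; apply: lF.
have := free_adj ul ladj; rewrite /free size_map => /eqP dl.
split=> [|sl p Fp]; first by rewrite -dl dimvS.
suff -> : <<[seq vec x y | y <- l]>>%VS = U by exact: UF.
by apply/eqP; rewrite eqEdim sU dl sl /=.
Qed.

Definition lattice_face (G : L -> Prop) : Prop :=
  exists2 F, face P F & forall x, G x <-> F (vtx x).

(** As in the simplex method, [vtx y - vtx x] is a nonnegative combination of edge vectors at [x].
    The functional [a] supporting [F] vanishes on it, so only edges inside [F] occur with positive
    coefficient; if none of them ascended, neither would the cost. *)
Lemma lattice_face_ascent G x y : lattice_face G -> G x -> G y -> cost x < cost y ->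
  exists2 z, covers x z & G z.
Proof.
move=> [F fF GF] /GF Fx /GF Fy xy; apply: contrapT => noz.
have [a aF] := faceP fF Fx.
have := cone_nbs x (face_sub fF Fy).
pose K v := dotp a v <= 0 /\ (dotp a v = 0 -> dotp c v <= 0).
have : K 0 by split => [|_]; rewrite dotp0r.
move=> K0 /(incone_ind K0)[] //.
  move=> t v w t0 /mapP[z]; rewrite mem_nbs => /asboolP xz -> [aw cw].
  have [az zE] := aF _ (P_vtx z).
  have az0 : dotp a (vec x z) <= 0 by rewrite dotpBr subr_le0.
  split; first by rewrite dotpDr dotpZr ler_wnDr // mulr_ge0_le0.
  rewrite !dotpDr !dotpZr => /eqP; rewrite naddr_eq0 ?mulr_ge0_le0 //.
  move=> /andP[taz /eqP/cw cw0]; rewrite ler_wnDr //.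
  move: taz; rewrite mulf_eq0 => /orP[/eqP->|]; first by rewrite mul0r.
  rewrite dotpBr subr_eq0 => /eqP/zE/GF Gz; rewrite mulr_ge0_le0 // dotpBr subr_le0.
  case: xz => [xz|zx]; last exact/ltW/cost_covers.
  by case: noz; exists z.
move=> _; rewrite !dotpBr (proj1 (proj2 (aF _ (P_vtx y))) Fy) subrr => /(_ erefl).
by rewrite subr_le0 leNgt xy.
Qed.

(** Simplicity gives a face of dimension [#|S|], whose direction space is spanned by the edges to
    [S]; a further cover of [x] in it would violate linear independence. *)
Lemma lattice_face_span x (S : {set L}) : (forall z, z \in S -> covers x z) ->
  exists G, [/\ lattice_face G, G x, forall z, z \in S -> G z
    & forall z, covers x z -> G z -> z \in S].
Proof.
move=> Sx.
have uS := enum_uniq (mem S).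
have adjS : {in enum S, forall y, adjacent x y}.
  by move=> y; rewrite mem_enum => /Sx; left.
have [F [fF dF Fx lF]] := simple_face uS adjS.
exists (fun z => F (vtx z)); split => //; first by exists F.
  by move=> z zS; apply: lF; rewrite mem_enum.
move=> z xz Fz; apply: contraT => zS.
have [_ /(_ erefl) spanF] := adj_in_face fF dF Fx uS adjS lF.
have : free [seq vec x y | y <- z :: enum S].
  apply: free_adj => [|y]; first by rewrite /= mem_enum zS.
  by rewrite inE => /orP[/eqP->|/adjS//]; left.
by rewrite /= free_cons (spanF _ Fz).
Qed.

(** Both clauses of [planar] count dimensions at [y]: two edges in [F] span its directions, on which
    a functional supporting the other face is then constant, and three edges are too many for
    dimension 2. *)
Lemma lattice_face_pair x p q : covers x p -> covers x q -> p <> q ->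
  exists Q, [/\ lattice_face Q, planar lattice_face Q, Q x, Q p & Q q].
Proof.
move=> xp xq pq.
have [||F [fF dF Fx lF]] := @simple_face x [:: p; q].
- by rewrite /= inE andbT; apply/eqP.
- by move=> y; rewrite !inE => /orP[] /eqP->; left.
exists (fun z => F (vtx z)); split; first by exists F.
- split.
    move=> y z z' Fy Fz Fz' yz yz' zz' G [F' fF' GF'] /GF' F'y /GF' F'z /GF' F'z' w Fw.
    apply/GF'; have [a aF'] := faceP fF' F'y.
    have [||| _ /(_ erefl) /(_ _ Fw) ] := @adj_in_face F 2 y [:: z; z'] fF dF Fy.
    + by rewrite /= inE andbT; apply/eqP.
    + by move=> ?; rewrite !inE => /orP[] /eqP->.
    + by move=> ?; rewrite !inE => /orP[] /eqP->.
    move=> wspan; apply: (proj2 (proj2 (aF' _ (P_vtx w)))).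
    have aE v : F' (vtx v) -> dotp a (vec y v) = 0.
      by move/(proj2 (aF' _ (P_vtx v))); rewrite dotpBr => ->; rewrite subrr.
    apply/eqP; rewrite -subr_eq0 -dotpBr; apply/eqP.
    move: wspan; rewrite /= span_cons span_seq1.
    move=> /memv_addP[_ /vlineP[k ->] [_ /vlineP[k' ->] ->]].
    by rewrite dotpDr !dotpZr !aE // !mulr0 addr0.
  move=> y z1 z2 z3 Fy F1 F2 F3 y1 y2 y3 n12 n13 n23.
  have [||| ] // := @adj_in_face F 2 y [:: z1; z2; z3] fF dF Fy.
  + by rewrite /= !inE negb_or !andbT; apply/andP; split; [apply/andP; split|]; apply/eqP.
  + by move=> ?; rewrite !inE => /or3P[] /eqP->.
  + by move=> ?; rewrite !inE => /or3P[] /eqP->.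
- exact: Fx.
- by apply: lF; rewrite inE eqxx.
- by apply: lF; rewrite !inE eqxx orbT.
Qed.

End SimplePolytopeLattice.

(** * The crosscut formula *)

(** Inserting or removing [a] pairs off subsets of opposite sign. *)
Lemma alternating_powerset (T : finType) (A : {set T}) (a : T) : a \in A ->
  \sum_(S : {set T} | S \subset A) (-1) ^+ #|S| = 0 :> int.
Proof.
move=> aA; rewrite (bigID (fun S : {set T} => a \in S)) /=.
rewrite (reindex_onto (fun S => a |: S)%SET (fun S => S :\ a)%SET) /=; last first.
  by move=> S /andP[_ aS]; rewrite finset.setD1K.
rewrite [X in X + _](eq_bigl (fun S : {set T} => (S \subset A) && (a \notin S))).
  rewrite -big_split big1 //= => S /andP[_ aS].
  by rewrite cardsU1 aS exprS mulN1r addNr.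
move=> S; rewrite finset.setU11 andbT finset.subUset finset.sub1set aA /=.
case: (boolP (a \in S)) => aS.
  by rewrite andbF; apply/andP => -[_ /eqP e]; move: aS; rewrite -e !inE eqxx.
by rewrite finset.setU1K // eqxx.
Qed.

(** * Joins of covers of a fixed element, and the Möbius function above it *)

Section CoverJoins.
Context {disp : Order.disp_t} {L : finLatticeType disp}.
Variable u : L.
Implicit Types (a b v y z : L) (S : {set L}).

Definition upper_covers : {set L} := [set a | `[< covers u a >]]%SET.
Definition covers_below z : {set L} := [set a in upper_covers | (a <= z)%O]%SET.
(** Starting from [u] makes the empty join the bottom of the interval. *)
Definition join_of S : L := \big[Order.join/u]_(a in S) a.

Lemma upper_coversP a : reflect (covers u a) (a \in upper_covers).
Proof. by rewrite inE; exact: asboolP. Qed.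

Lemma join_of_le S y : (join_of S <= y)%O = (u <= y)%O && [forall a in S, (a <= y)%O].
Proof.
rewrite /join_of; transitivity
  ((u <= y)%O && all (fun a => (a \in S) ==> (a <= y)%O) (index_enum L)).
  elim: index_enum => [|a s IH]; first by rewrite big_nil andbT.
  rewrite big_cons /=; case: ifP => _ //=.
  by rewrite leUx IH andbCA.
congr (_ && _); apply/allP/forall_inP => [h a aS|h a _]; last by apply/implyP => /h.
by have /implyP := h a (mem_index_enum a); apply.
Qed.

Lemma join_of_ge S : (u <= join_of S)%O.
Proof. by have := join_of_le S (join_of S); rewrite lexx => /esym/andP[]. Qed.

Lemma join_of_ub S a : a \in S -> (a <= join_of S)%O.
Proof.
by have := join_of_le S (join_of S); rewrite lexx => /esym/andP[_ /forall_inP]; apply.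
Qed.

Lemma join_of_sub S S' : S \subset S' -> (join_of S <= join_of S')%O.
Proof.
move=> /fintype.subsetP SS'; rewrite join_of_le join_of_ge; apply/forall_inP => a /SS'.
exact: join_of_ub.
Qed.

Lemma mem_covers_below z a : a \in covers_below z -> covers u a /\ (a <= z)%O.
Proof. by rewrite inE => /andP[/upper_coversP]. Qed.

Lemma covers_below_sub y z : (y <= z)%O -> covers_below y \subset covers_below z.
Proof.
move=> yz; apply/fintype.subsetP => a; rewrite inE [in X in _ -> X]inE.
by move=> /andP[-> /le_trans]; apply.
Qed.

Lemma join_covers_below_le z : (u <= z)%O -> (join_of (covers_below z) <= z)%O.
Proof.
by move=> uz; rewrite join_of_le uz; apply/forall_inP => a /mem_covers_below[].
Qed.

Lemma covers_below_neq0 z : (u < z)%O -> exists a, a \in covers_below z.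
Proof.
move=> /exists_cover_above[a ua az]; exists a.
by rewrite inE az andbT; apply/upper_coversP.
Qed.

Lemma covers_below_upper z : covers_below z \subset upper_covers.
Proof. by apply/fintype.subsetP => a; rewrite inE => /andP[]. Qed.

(** The form in which the polytope enters the rest of the argument: [join_of] embeds the subsets of
    the upper covers, with left inverse [covers_below]. *)
Definition independent_covers := forall S a, S \subset upper_covers ->
  a \in upper_covers -> a \notin S -> ~~ (a <= join_of S)%O.

Hypothesis indep : independent_covers.

Lemma covers_below_join S : S \subset upper_covers -> covers_below (join_of S) = S.
Proof.
move=> SC; apply/setP => a; rewrite inE.
case: (boolP (a \in S)) => aS.
  by rewrite join_of_ub // andbT; have /fintype.subsetP/(_ a aS) := SC.
by apply/negbTE/negP => /andP[aC]; apply/negP; apply: indep.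
Qed.

(** Both sides are 1 at [u] and sum to 0 over each interval from [u] to some [v] above it. For the
    right-hand side, only joins of subsets of [covers_below v] contribute, each coming from exactly
    one subset, so the sum is an alternating sum over a power set. *)
Lemma mobius_crosscut v : (u <= v)%O -> mobius u v =
  if join_of (covers_below v) == v then (-1) ^+ #|covers_below v| else 0.
Proof.
elim/(@finord_ind_up _ L): v => v IH.
rewrite le_eqVlt => /orP[/eqP<-|uv].
  rewrite mobiusxx (_ : covers_below u = finset.set0); last first.
    apply/setP => a; rewrite [RHS]inE; apply/negP => /mem_covers_below[[ua _] au].
    by move: (lt_le_trans ua au); rewrite ltxx.
  by rewrite /join_of finset.big_set0 eqxx cards0.
have := mobius_sum uv.
have -> : \sum_(z | (u <= z <= v)%O) mobius u z =
  \sum_(z | (u <= z <= v)%O) (if join_of (covers_below z) == z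
     then (-1) ^+ #|covers_below z| else 0) + (mobius u v -
    (if join_of (covers_below v) == v then (-1) ^+ #|covers_below v| else 0)).
  rewrite (bigD1 v) ?(ltW uv) ?lexx //= [in RHS](bigD1 v) ?(ltW uv) ?lexx //=.
  rewrite (eq_bigr (fun z => if join_of (covers_below z) == z
     then (-1) ^+ #|covers_below z| else 0)); first by ring.
  move=> z /andP[/andP[uz zv] nz]; apply: IH => //.
  by rewrite lt_neqAle nz zv.
rewrite -big_mkcondr.
rewrite (reindex_onto join_of covers_below) /=; last by move=> z /andP[_ /eqP].
rewrite (eq_bigl (fun S : {set L} => S \subset covers_below v)).
  have [a av] := covers_below_neq0 uv.
  rewrite (eq_bigr (fun S : {set L} => (-1) ^+ #|S|)).
    by rewrite (alternating_powerset av) add0r => /eqP; rewrite subr_eq0 => /eqP.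
  move=> S Sv; rewrite covers_below_join //.
  exact: fintype.subset_trans Sv (covers_below_upper v).
move=> S; apply/idP/idP.
  move=> /andP[/andP[/andP[_ Sv] _] /eqP <-].
  exact: covers_below_sub.
move=> Sv; have SC := fintype.subset_trans Sv (covers_below_upper v).
rewrite covers_below_join // !eqxx !andbT join_of_ge /= join_of_le (ltW uv).
by apply/forall_inP => a aS; have /fintype.subsetP/(_ a aS)/mem_covers_below[] := Sv.
Qed.

Lemma mobius_values v : (u <= v)%O -> mobius u v \in [:: 0; 1; -1].
Proof.
move=> uv; rewrite mobius_crosscut //; case: ifP => _ //.
by rewrite -signr_odd; case: odd.
Qed.

End CoverJoins.

(** * Homotopies between chains *)

Section ContinuityAt.
Variables (R : realType) (T : topologicalType).
Implicit Types (x : T).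

Lemma ptws_continuous_at (I : choiceType) (V : topologicalType)
    (f : T -> {ptws I -> V}) x :
  (forall i, {for x, continuous (fun y => f y i)}) -> {for x, continuous f}.
Proof.
move=> H; apply/cvg_sup => i A nA; move: (nA); rewrite nbhsE.
move=> [B [[C oC <-] /= Cfx] BA].
apply: (@filterS _ (f @ x) _ _ _ BA).
by apply: (H i); apply: open_nbhs_nbhs; split.
Qed.

Lemma mx_continuous_at m n (f : T -> 'M[R]_(m, n)) x :
  (forall i j, {for x, continuous (fun y => f y i j)}) -> {for x, continuous f}.
Proof.
move=> H A [B Bfx BA]; apply: (filterS BA) => /=.
have : \forall y \near x, forall ij : 'I_m * 'I_n, B ij.1 ij.2 (f y ij.1 ij.2).
  by apply: filter_forall => -[i j] /=; exact: H.
by apply: filterS => y H' i j; exact: (H' (i, j)).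
Qed.

Lemma sum_continuous_at (I : Type) (r : seq I) (Q : pred I) (F : I -> T -> R) x :
  (forall i, {for x, continuous (F i)}) ->
  {for x, continuous (fun y => \sum_(i <- r | Q i) F i y)}.
Proof.
move=> cF; apply: (@cvg_big _ _ _ _ _ _ _ _ _ F (fun i => F i x)) => [|i _].
  exact: add_continuous.
exact: cF.
Qed.

Lemma prod_continuous_at (I : Type) (r : seq I) (Q : pred I) (F : I -> T -> R) x :
  (forall i, {for x, continuous (F i)}) ->
  {for x, continuous (fun y => \prod_(i <- r | Q i) F i y)}.
Proof.
move=> cF; apply: (@cvg_big _ _ _ _ _ _ _ _ _ F (fun i => F i x)) => [|i _].
  exact: mul_continuous.
exact: cF.
Qed.

Lemma cst_continuous_at (U : topologicalType) (k : U) x :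
  {for x, continuous (fun _ : T => k)}.
Proof. exact: cvg_cst. Qed.

Lemma add_continuous_at (f g : T -> R) x : {for x, continuous f} ->
  {for x, continuous g} -> {for x, continuous (fun y => f y + g y)}.
Proof. exact: cvgD. Qed.

Lemma sub_continuous_at (f g : T -> R) x : {for x, continuous f} ->
  {for x, continuous g} -> {for x, continuous (fun y => f y - g y)}.
Proof. exact: cvgB. Qed.

Lemma mul_continuous_at (f g : T -> R) x : {for x, continuous f} ->
  {for x, continuous g} -> {for x, continuous (fun y => f y * g y)}.
Proof. exact: cvgM. Qed.

Lemma min_continuous_at (f g : T -> R) x : {for x, continuous f} ->
  {for x, continuous g} -> {for x, continuous (fun y => Num.min (f y) (g y))}.
Proof. exact: continuous_min. Qed.

Lemma max_continuous_at (f g : T -> R) x : {for x, continuous f} ->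
  {for x, continuous g} -> {for x, continuous (fun y => Num.max (f y) (g y))}.
Proof. exact: continuous_max. Qed.

Lemma within_continuous_at (U : topologicalType) (A : set T) (f : T -> U) :
  (forall x, A x -> {for x, continuous f}) -> {within A, continuous f}.
Proof. by move=> cf; apply: continuous_in_subspaceT => x; rewrite inE => /cf. Qed.

End ContinuityAt.

(** * Deforming an order complex along a decreasing monotone map *)

Section ChainPushing.
Variables (R : realType) (disp : Order.disp_t) (T : finPOrderType disp).
Implicit Types (x : {ptws T -> R}) (t : R) (y z w : T).

Lemma in_order_complex (A : {set T}) x :
  ([set z | x z != 0]%SET \in order_complex A) <->
  (forall z, x z != 0 -> z \in A) /\
  (forall z w, x z != 0 -> x w != 0 -> (z >=< w)%O).
Proof.
have S z : x z != 0 -> z \in [set z | x z != 0]%SET by rewrite inE.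
rewrite inE; split=> [/andP[/fintype.subsetP sA /forall_inP ch]|[sA ch]].
  split=> [z /S/sA//|z w /S/ch/forall_inP zw /S/zw//].
apply/andP; split; first by apply/fintype.subsetP => z; rewrite inE => /sA.
apply/forall_inP => z; rewrite inE => xz; apply/forall_inP => w; rewrite inE.
exact: ch.
Qed.

Variables (A : {set T}) (r : T -> T).
Hypothesis rA : {in A, forall z, r z \in A}.
Hypothesis r_le : forall z, z \in A -> (r z <= z)%O.
Hypothesis r_homo : {in A &, forall z w, (z <= w)%O -> (r z <= r w)%O}.

Let K := realization R (order_complex A).

(* Transports the mass of [x] along [r], starting from the bottom of the chain
   supporting [x], until the amount [t] has been moved: in between, what has been
   moved lies below what has not. *)
Definition moved t x z : R :=
  Num.min (x z) (Num.max 0 (t - \sum_(y | (y < z)%O) x y)).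

Definition push t x z : R :=
  x z - moved t x z + \sum_(y | r y == z) moved t x y.

Lemma moved_continuous_at (S : topologicalType) (f : S -> R)
    (g : S -> {ptws T -> R}) s z :
  {for s, continuous f} -> (forall y, {for s, continuous (fun a => g a y)}) ->
  {for s, continuous (fun a => moved (f a) (g a) z)}.
Proof.
move=> cf cg; apply: min_continuous_at; first exact: cg.
apply: max_continuous_at; first exact: cst_continuous_at.
apply: sub_continuous_at; first exact: cf.
by apply: sum_continuous_at.
Qed.

Lemma push_continuous_at (S : topologicalType) (f : S -> R)
    (g : S -> {ptws T -> R}) s z :
  {for s, continuous f} -> (forall y, {for s, continuous (fun a => g a y)}) ->
  {for s, continuous (fun a => push (f a) (g a) z)}.
Proof.
move=> cf cg; apply: add_continuous_at; last first.
  by apply: sum_continuous_at => y; exact: moved_continuous_at.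
by apply: sub_continuous_at; [exact: cg|exact: moved_continuous_at].
Qed.

Lemma moved_ge0 t x z : (forall y, 0 <= x y) -> 0 <= moved t x z.
Proof. by move=> x0; rewrite le_min x0 le_max lexx. Qed.

Lemma moved_le t x z : moved t x z <= x z.
Proof. by rewrite ge_min lexx. Qed.

Lemma push_ge0 t x z : (forall y, 0 <= x y) -> 0 <= push t x z.
Proof.
move=> x0; rewrite addr_ge0 ?subr_ge0 ?moved_le // sumr_ge0 // => y _.
exact: moved_ge0.
Qed.

Lemma push_sum t x : \sum_z push t x z = \sum_z x z.
Proof.
rewrite big_split /= sumrB -[RHS]addr0 -addrA; congr (_ + _).
apply/eqP; rewrite addrC subr_eq0; apply/eqP.
by rewrite [RHS](partition_big r xpredT).
Qed.

Lemma push0 x z : (forall y, 0 <= x y) -> push 0 x z = x z.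
Proof.
move=> x0; have m0 y : moved 0 x y = 0.
  apply/eqP; rewrite eq_le moved_ge0 // andbT ge_min orbC ge_max lexx /=.
  by rewrite sub0r oppr_le0 sumr_ge0.
by rewrite /push m0 subr0 big1 ?addr0.
Qed.

Lemma moved1 x z : (forall y, 0 <= x y) -> \sum_y x y = 1 -> moved 1 x z = x z.
Proof.
move=> x0 x1; apply/min_idPl; rewrite le_max; apply/orP; right.
rewrite lerBrDr -x1 [leRHS](bigD1 z) //= lerD2l.
rewrite [leRHS](bigID (fun y => (y < z)%O)) /=.
rewrite [X in _ <= X + _](eq_bigl (fun y => (y < z)%O)) ?lerDl ?sumr_ge0 // => y.
by case: (boolP (y < z)%O) => [/lt_eqF->|]; rewrite ?andbF.
Qed.

Lemma push_support t x z : K x -> push t x z != 0 ->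
  (x z != 0 /\ moved t x z < x z) \/
  exists y, [/\ r y = z, x y != 0 & 0 < moved t x y].
Proof.
move=> [x0 _ _] pz; have := moved_le t x z; rewrite le_eqVlt => /orP[/eqP mz|mz]; last first.
  by left; split=> //; rewrite gt_eqF // (le_lt_trans _ mz) // moved_ge0.
right; move: pz; rewrite /push mz subrr add0r psumr_neq0 => [/hasP[y _]|y _]; last first.
  exact: moved_ge0.
move=> /andP[/eqP ry my]; exists y; split=> //.
by rewrite gt_eqF // (lt_le_trans my) // moved_le.
Qed.

(** If [z] were strictly below [y], the mass below [y] would include that at [z] and all mass below
    [z], so nothing at [y] could move before [z] was exhausted. *)
Lemma moved_below t x y z : K x -> x y != 0 -> x z != 0 ->
  0 < moved t x y -> moved t x z < x z -> (y <= z)%O.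
Proof.
move=> [x0 _ /in_order_complex[_ ch]] xy xz.
rewrite lt_min lt_max ltxx /= subr_gt0 => /andP[_ ty].
rewrite gt_min ltxx /= gt_max => /andP[_ tz].
have /orP[//|zy] := ch _ _ xy xz; move: zy; rewrite le_eqVlt => /orP[/eqP->//|zy].
suff : \sum_(w | (w < z)%O) x w + x z <= \sum_(w | (w < y)%O) x w.
  by move=> le; exfalso; lra.
rewrite [leRHS](bigID (fun w => (w < z)%O)) /= lerD //.
  rewrite [leRHS](eq_bigl (fun w => (w < z)%O)) // => w.
  by case: (boolP (w < z)%O) => [/lt_trans->|]; rewrite ?andbF.
rewrite (bigD1 z) /=; last by rewrite zy ltxx.
by rewrite lerDl sumr_ge0.
Qed.

(** The image of a moved element lies below that element, hence below all that still carries unmoved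
    mass; two images are comparable because [r] is monotone. *)
Lemma push_chain t x z w : K x -> push t x z != 0 -> push t x w != 0 -> (z >=< w)%O.
Proof.
move=> Kx; have [_ _ /in_order_complex[xA ch]] := Kx.
move=> /(push_support Kx)[[xz mz]|[y [<- xy my]]]
       /(push_support Kx)[[xw mw]|[y' [<- xy' my']]].
- exact: ch.
- rewrite comparable_sym; apply: le_comparable; apply: le_trans (r_le (xA _ xy')) _.
  exact: moved_below mz.
- apply: le_comparable; apply: le_trans (r_le (xA _ xy)) _.
  exact: moved_below mw.
- have /orP[h|h] := ch _ _ xy xy'.
    by apply: le_comparable; apply: r_homo => //; exact: xA.
  by rewrite comparable_sym; apply: le_comparable; apply: r_homo => //; exact: xA.
Qed.

Lemma push_in t x z : K x -> push t x z != 0 -> z \in A.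
Proof.
move=> Kx; have [_ _ /in_order_complex[xA ch]] := Kx.
move=> /(push_support Kx)[[xz mz]|[y [<- xy my]]]; first exact: xA.
exact/rA/xA.
Qed.

Lemma homotopic_push (h : {ptws T -> R} -> {ptws T -> R}) :
  (forall x, K x -> {for x, continuous h}) -> set_fun K K h ->
  (forall x z w, K x -> h x z != 0 -> x w != 0 -> (z >=< r w)%O) ->
  homotopic_in R K K h id.
Proof.
(* First the segment from [h x] to the image of [x] under [r], then the push
   backwards. *)
move=> ch hK hr.
(* [a] grows from 0 to 1 in the first half of the time and [b] in the second; each is constant in
   the other half. *)
pose a (p : R * {ptws T -> R}) : R := Num.min 1 (2 * p.1).
pose b (p : R * {ptws T -> R}) : R := Num.max 0 (2 * p.1 - 1).
pose H p : {ptws T -> R} :=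
  fun z => (1 - a p) * h p.2 z + a p * push (1 - b p) p.2 z.
have c1 p : {for p, continuous (fun q : R * {ptws T -> R} => q.1)} by exact: cvg_fst.
have ca p : {for p, continuous a}.
  apply: min_continuous_at; first exact: cst_continuous_at.
  by apply: mul_continuous_at; [exact: cst_continuous_at|exact: c1].
have cb p : {for p, continuous b}.
  apply: max_continuous_at; first exact: cst_continuous_at.
  apply: sub_continuous_at; last exact: cst_continuous_at.
  by apply: mul_continuous_at; [exact: cst_continuous_at|exact: c1].
have ev z x : {for x, continuous (fun x : {ptws T -> R} => x z)}.
  exact: proj_continuous.
have c2 z p : {for p, continuous (fun q : R * {ptws T -> R} => q.2 z)}.
  apply: (@continuous_comp _ _ _ snd (fun x : {ptws T -> R} => x z)); last exact: ev.
  exact: cvg_snd.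
exists H; split.
- apply: within_continuous_at => p [_ Kp]; apply: ptws_continuous_at => z.
  apply: add_continuous_at; apply: mul_continuous_at.
  + by apply: sub_continuous_at; [exact: cst_continuous_at|exact: ca].
  + apply: (@continuous_comp _ _ _ snd (fun x => h x z)); first exact: cvg_snd.
    apply: (@continuous_comp _ _ _ h (fun x : {ptws T -> R} => x z)); last exact: ev.
    exact: ch.
  + exact: ca.
  + apply: (@push_continuous_at _ (fun p => 1 - b p) snd) => //.
    by apply: sub_continuous_at; [exact: cst_continuous_at|exact: cb].
- move=> [t x] [/= t01 Kx]; have Khx := hK x Kx.
  have [x0 x1 /in_order_complex[xA xch]] := Kx.
  have [y0 y1 /in_order_complex[yA ych]] := Khx.
  have [t0 t1] : 0 <= t /\ t <= 1 by move: t01; rewrite in_itv /= => /andP[].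
  have [a0 a1] : 0 <= a (t, x) /\ 0 <= 1 - a (t, x).
    by rewrite /a /= le_min ler01 mulr_ge0 // subr_ge0 ge_min lexx.
  have ab : a (t, x) = 1 \/ b (t, x) = 0.
    have [h2|h2] := leP (2 * t) 1; last by left; apply: min_l; exact: ltW.
    by right; apply: max_l; rewrite subr_le0.
  have supp z : H (t, x) z != 0 ->
      (h x z != 0 /\ b (t, x) = 0) \/ push (1 - b (t, x)) x z != 0.
    rewrite /H /=; have [->|] := eqVneq (push (1 - b (t, x)) x z) 0; last by right.
    rewrite mulr0 addr0 mulf_eq0 negb_or => /andP[na nh]; left; split=> //.
    by case: ab => // e; rewrite e subrr eqxx in na.
  (* At [b = 0] all mass has been moved, so the pushed point is supported on values of [r], which
     [hr] compares with the support of [h x]. *)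
  have mix z w : h x z != 0 -> b (t, x) = 0 -> push (1 - b (t, x)) x w != 0 ->
      (z >=< w)%O.
    move=> hz -> /(push_support Kx); rewrite subr0 moved1 // ltxx.
    move=> [[]//|[y [<- xy _]]].
    exact: hr xy.
  split.
  + by move=> z; apply: addr_ge0; apply: mulr_ge0 => //; exact: push_ge0.
  + rewrite /H big_split -!mulr_sumr /= y1 push_sum x1 !mulr1.
    by rewrite subrK.
  + apply/in_order_complex; split=> [z /supp[[/yA//]|/(push_in Kx)//]|z w].
    move=> /supp[[hz b0]|pz] /supp[[hw b0']|pw].
    * exact: ych.
    * exact: mix pw.
    * by rewrite comparable_sym; exact: mix pz.
    * exact: push_chain pz pw.
- move=> x _; apply/funext => z; rewrite /H /a /b /=.
  by rewrite mulr0 (min_idPr _) // subr0 mul1r mul0r addr0.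
- move=> x; rewrite inE => -[x0 _ _]; apply/funext => z; rewrite /H /a /b /=.
  rewrite mulr1 (min_idPl _) ?ler1n // (max_idPr _) ?subr_ge0 ?ler1n //.
  by rewrite subrr mul0r add0r mul1r (_ : 1 - (2 - 1) = 0) ?push0 //; ring.
Qed.

End ChainPushing.

(** * Homotopy type of the open intervals *)

Section OpenIntervals.
Variables (R : realType) (disp : Order.disp_t) (L : finLatticeType disp) (u v : L).
Hypothesis indep : independent_covers u.
Hypothesis uv : (u < v)%O.
Implicit Types (a b y z : L) (x : {ptws L -> R}).

Let A := covers_below u v.
Let I := open_itv u v.
Let r z := join_of u (covers_below u z).
Let K := realization R (order_complex I).

Let in_I z : (z \in I) = (u < z < v)%O. Proof. by rewrite inE. Qed.

Let gt_join (S : {set L}) a : S \subset upper_covers u -> a \in S -> (u < join_of u S)%O.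
Proof.
move=> /fintype.subsetP SC aS; have /upper_coversP[ua _] := SC a aS.
exact: lt_le_trans ua (join_of_ub u aS).
Qed.

Let r_le z : z \in I -> (r z <= z)%O.
Proof. by rewrite in_I => /andP[/ltW uz _]; apply: join_covers_below_le. Qed.

Let r_in : {in I, forall z, r z \in I}.
Proof.
move=> z zI; move: (zI); rewrite !in_I => /andP[uz zv].
rewrite (le_lt_trans (r_le zI) zv) andbT.
have [a aS] := covers_below_neq0 uz.
exact: gt_join (covers_below_upper _ _) aS.
Qed.

Let r_homo : {in I &, forall z w, (z <= w)%O -> (r z <= r w)%O}.
Proof. by move=> z w _ _ /(covers_below_sub u)/(join_of_sub u). Qed.

Let below_r z : covers_below u (r z) = covers_below u z.
Proof. exact: covers_below_join (covers_below_upper _ _). Qed.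

Let below_A z : z \in I -> covers_below u z \subset A.
Proof. by rewrite in_I => /andP[_ /ltW]; exact: covers_below_sub. Qed.

Let eval_continuous (S : topologicalType) (h : S -> {ptws L -> R}) s z :
  {for s, continuous h} -> {for s, continuous (fun q => h q z)}.
Proof.
move=> ch; apply: (@continuous_comp _ _ _ h (fun x : {ptws L -> R} => x z)) => //.
exact: proj_continuous.
Qed.

Let K_supp x : K x -> exists z, x z != 0.
Proof.
move=> [_ x1 _]; apply: contrapT => nz; move: x1; rewrite big1 => [|z _].
  by move=> /eqP; rewrite eq_sym oner_eq0.
by apply/eqP; apply: contraT => xz; case: nz; exists z.
Qed.

(** The join [j] of [A] lies in the interval and above every [r w], so the constant map to the
    vertex [j] is homotopic to the identity. The ball of dimension 0 is a point. *)
Lemma open_itv_ball : join_of u A != v ->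
  homotopy_equivalent R (realization R (order_complex (open_itv u v))) (unit_ball R 0).
Proof.
move=> jv; set j := join_of u A in jv.
have [a aA] := covers_below_neq0 uv.
have jI : j \in I.
  rewrite in_I (gt_join (covers_below_upper _ _) aA) lt_neqAle jv.
  by rewrite join_covers_below_le ?ltW.
pose e : {ptws L -> R} := fun z => (z == j)%:R.
have ej z : e z != 0 -> z = j.
  by have [->|/negbTE ne] := eqVneq z j; rewrite // /e ne eqxx.
have eK : K e.
  split.
  - by move=> z; rewrite ler0n.
  - by rewrite (bigD1 j) //= /e eqxx big1 ?addr0 // => z /negbTE->.
  - by apply/in_order_complex; split=> [z /ej->//|z w /ej-> /ej->]; apply: comparablexx.
exists (fun=> 0), (fun=> e); split.
- split; first by apply: within_continuous_at => x _; exact: cst_continuous_at.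
  by move=> x _; rewrite /unit_ball /= big_ord0.
- by split; [apply: within_continuous_at => x _; exact: cst_continuous_at|move=> x _].
- apply: (homotopic_push (r := r)) => //.
  + by move=> x _; exact: cst_continuous_at.
  + move=> x z w [_ _ /in_order_complex[xI _]] /ej-> xw.
    by rewrite comparable_sym; apply: le_comparable; apply: join_of_sub; apply/below_A/xI.
- exists snd; split.
  + by apply: within_continuous_at => x _; exact: cvg_snd.
  + by move=> [t w] [].
  + by move=> w _; rewrite [LHS]thinmx0 [RHS]thinmx0.
  + by [].
Qed.

(** * The case where the covers below [v] join to [v] *)

Section Sphere.
Hypothesis joinA : join_of u A = v.
Variable a0 : L.
Hypothesis a0A : a0 \in A.

(** The sphere in [n] coordinates has dimension [n - 1], that is [#|A| - 2]. For [A] a singleton,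
    [v] covers [u], and both the interval and the sphere are empty. *)
Let n := #|(A :\ a0)%SET|.
Let atom (i : 'I_n) : L := enum_val i.
Implicit Types (w : 'rV[R]_n) (i : 'I_n).

Let atomA i : atom i \in A.
Proof. by have := enum_valP i; rewrite !inE => /andP[]. Qed.

Let atom_neq i : atom i != a0.
Proof. by have := enum_valP i; rewrite !inE => /andP[]. Qed.

Let atom_onto a : a \in A -> a != a0 -> exists i, atom i = a.
Proof.
move=> aA an; have aD : a \in (A :\ a0)%SET by rewrite finset.in_setD1 an.
exists (enum_rank_in aD a); exact: (enum_rankK_in aD).
Qed.

Let below_ex z : z \in I -> exists a b,
  [/\ a \in covers_below u z, b \in A & b \notin covers_below u z].
Proof.
move=> zI; move: (zI); rewrite in_I => /andP[uz zv].
have [a az] := covers_below_neq0 uz; exists a.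
have /subsetPn[b bA bz] : ~~ (A \subset covers_below u z).
  apply/negP => /(join_of_sub u); rewrite joinA => vr.
  by have := lt_le_trans zv (le_trans vr (r_le zI)); rewrite ltxx.
by exists b.
Qed.

(* The sphere is realized in [R^A] modulo constants, normalized by the vanishing
   of the coordinate [a0]; [coord w] is the vector so represented by [w]. *)
Let coord w a : R := \sum_(i | atom i == a) w 0 i.

Let coord_atom w i : coord w (atom i) = w 0 i.
Proof.
rewrite /coord (eq_bigl (pred1 i)) ?big_pred1_eq // => j.
by rewrite (inj_eq enum_val_inj).
Qed.

Let coord_a0 w : coord w a0 = 0.
Proof. by rewrite /coord big_pred0 // => i; apply: negbTE. Qed.

Let coordD w w' a : coord (w + w') a = coord w a + coord w' a.
Proof. by rewrite /coord -big_split; apply: eq_bigr => i _; rewrite mxE. Qed.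

Let coordZ (k : R) w a : coord (k *: w) a = k * coord w a.
Proof. by rewrite /coord mulr_sumr; apply: eq_bigr => i _; rewrite mxE. Qed.

Let coord_neq0 w a b : coord w b < coord w a -> w != 0.
Proof.
apply: contraTneq => ->; rewrite -leNgt -(scale0r (0 : 'rV[R]_n)) !coordZ.
by rewrite !mul0r.
Qed.

(** The coordinates, for [a] in [A], of the sum over [z] of [x z] times the indicator vector of
    [covers_below u z]; [xi] is this vector modulo constants. *)
Let mass x a : R := \sum_(z | (a <= z)%O) x z.
Let xi x : 'rV[R]_n := \row_i (mass x (atom i) - mass x a0).

Let coord_xi x a : a \in A -> coord (xi x) a = mass x a - mass x a0.
Proof.
move=> aA; have [->|/(atom_onto aA)[i <-]] := eqVneq a a0.
  by rewrite coord_a0 subrr.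
by rewrite coord_atom mxE.
Qed.

(** The support of [x] is a chain, so its elements above [b] are above [z] and thus above [a];
    moreover [z] itself counts for [a] and not for [b]. *)
Let mass_lt x z a b : K x -> x z != 0 -> a \in covers_below u z -> b \in A ->
  b \notin covers_below u z -> mass x b < mass x a.
Proof.
move=> [x0 _ /in_order_complex[xI ch]] xz /mem_covers_below[ua az] bA bz.
have bnz : ~~ (b <= z)%O.
  by apply: contra bz; move: bA; rewrite !inE => /andP[-> _].
rewrite /mass [ltRHS](bigD1 z) //= -[ltLHS]add0r ltr_leD //.
  by rewrite lt_neqAle eq_sym xz x0.
rewrite big_mkcond [leRHS]big_mkcond; apply: ler_sum => y _.
case: ifP => [by_|_]; last by case: ifP.
have [->|xy] := eqVneq (x y) 0; first by case: ifP.
case: ifP => // /negbT/negP[]; apply/andP; split.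
  apply: le_trans az _; have /orP[//|yz] := ch _ _ xz xy.
  by rewrite (le_trans by_ yz) in bnz.
by apply: contra bnz => /eqP<-.
Qed.

(* Nonzero exactly when [z] is the join of a proper upper level set of [coord w];
   these joins form a chain. *)
Let weight w z : R := if (z \in I) && (r z == z)
  then \prod_(a in covers_below u z) \prod_(b in (A :\: covers_below u z)%SET)
         Num.max 0 (coord w a - coord w b)
  else 0.

Let weight_ge0 w z : 0 <= weight w z.
Proof.
rewrite /weight; case: ifP => // _; apply: prodr_ge0 => a _; apply: prodr_ge0 => b _.
by rewrite le_max lexx.
Qed.

Let weight_neq0 w z : weight w z != 0 <-> [/\ z \in I, r z = z
  & forall a b, a \in covers_below u z -> b \in A -> b \notin covers_below u z ->
      coord w b < coord w a].
Proof.
rewrite /weight; split.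
  case: ifP => [/andP[zI /eqP rz]|_]; last by rewrite eqxx.
  move=> nz; split=> // a b az bA bz; move: nz; apply: contraNT; rewrite -leNgt => ab.
  apply/prodf_eq0; exists a => //; apply/prodf_eq0; exists b.
    by rewrite finset.in_setD bz.
  by rewrite (max_idPl _) // subr_le0.
move=> [-> -> h]; rewrite eqxx; apply/prodf_neq0 => a az; apply/prodf_neq0 => b.
rewrite finset.in_setD => /andP[bz bA].
by rewrite gt_eqF // lt_max subr_gt0 h ?orbT.
Qed.

(** Upper level sets are nested: if [a] lay only in the first and [b] only in the second, each would
    have the strictly larger coordinate. *)
Let weight_chain w y z : weight w y != 0 -> weight w z != 0 -> (y >=< z)%O.
Proof.
move=> /weight_neq0[yI ry hy] /weight_neq0[zI rz hz].
have [yz|/subsetPn[a ay az]] := boolP (covers_below u y \subset covers_below u z).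
  by apply: le_comparable; rewrite -ry -rz; apply: join_of_sub.
rewrite comparable_sym; apply: le_comparable; rewrite -ry -rz; apply: join_of_sub.
apply/fintype.subsetP => b bz; apply: contraT => by_.
have aA := fintype.subsetP (below_A yI) _ ay.
have bA := fintype.subsetP (below_A zI) _ bz.
by have := lt_trans (hy a b ay bA by_) (hz b a bz aA az); rewrite ltxx.
Qed.

(** The set where [coord w] is maximal serves: it is proper because [coord w] vanishes at [a0] but
    not everywhere on [A]. *)
Let weight_ex w : w != 0 -> exists z, weight w z != 0.
Proof.
move=> w0; have [a1 a1A a1n] : exists2 a, a \in A & coord w a != 0.
  have [i wi] : exists i, w 0 i != 0.
    apply: contrapT => nw; case/eqP: w0; apply/rowP => i; rewrite mxE.
    by apply/eqP; apply: contraT => wi; case: nw; exists i.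
  by exists (atom i); rewrite ?coord_atom.
case: (@arg_maxP _ R L a0 (fun a => a \in A) (coord w) a0A) => m mA mmax.
pose S := [set a in A | coord w a == coord w m]%SET.
have SA : S \subset A by apply/fintype.subsetP => a; rewrite inE => /andP[].
have SC : S \subset upper_covers u := fintype.subset_trans SA (covers_below_upper _ _).
have mS : m \in S by rewrite inE mA eqxx.
have bS := covers_below_join indep SC.
have SnA : S != A.
  apply: contra a1n => /eqP SE.
  have : a0 \in S by rewrite SE.
  have : a1 \in S by rewrite SE.
  by rewrite !inE => /andP[_ /eqP->] /andP[_ /eqP<-]; rewrite coord_a0.
exists (join_of u S); apply/weight_neq0; split.
- rewrite in_I (gt_join SC mS) lt_neqAle /=; apply/andP; split.
    by apply: contra SnA => /eqP jv; rewrite -bS jv.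
  by rewrite -joinA join_of_sub.
- by rewrite /r bS.
- rewrite bS => a b; rewrite inE => /andP[aA /eqP->] bA; rewrite inE bA /= => nb.
  by rewrite lt_neqAle nb; exact: mmax.
Qed.

Let norm2 w : R := \sum_(i < n) w 0 i ^+ 2.
Let normalize w : 'rV[R]_n := (Num.sqrt (norm2 w))^-1 *: w.

Let norm2_gt0 w : w != 0 -> 0 < norm2 w.
Proof. exact: dotp_gt0. Qed.

Let normalize_sphere w : w != 0 -> unit_sphere R n (normalize w).
Proof.
move=> /norm2_gt0 w0; rewrite /unit_sphere /normalize /=.
under eq_bigr do rewrite mxE exprMn.
by rewrite -mulr_sumr exprVn sqr_sqrtr ?ltW // mulVf // gt_eqF.
Qed.

Let normalize_id w : unit_sphere R n w -> normalize w = w.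
Proof.
by rewrite /unit_sphere /normalize /norm2 /= => ->; rewrite sqrtr1 invr1 scale1r.
Qed.

Let sphere_neq0 w : unit_sphere R n w -> w != 0.
Proof.
apply: contraPneq => ->; rewrite /unit_sphere /= big1 => [/eqP|i _].
  by rewrite eq_sym oner_eq0.
by rewrite mxE expr0n.
Qed.

Let from_sphere w : {ptws L -> R} := fun z => weight w z / \sum_y weight w y.
Let to_sphere x := normalize (xi x).

Let weight_sum w : w != 0 -> 0 < \sum_y weight w y.
Proof.
move=> /weight_ex[z wz]; rewrite (bigD1 z) //= ltr_pwDl ?sumr_ge0 //.
by rewrite lt_neqAle eq_sym wz weight_ge0.
Qed.

Let from_sphere_neq0 w z : w != 0 -> (from_sphere w z != 0) = (weight w z != 0).
Proof.
by move=> w0; rewrite /from_sphere mulf_eq0 invr_eq0 (gt_eqF (weight_sum w0)) orbF.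
Qed.

Let from_sphere_K w : w != 0 -> K (from_sphere w).
Proof.
move=> w0; have ws := weight_sum w0; split.
- by move=> z; rewrite divr_ge0 // ltW.
- by rewrite -mulr_suml divff // gt_eqF.
- apply/in_order_complex; split=> [z|y z]; rewrite !from_sphere_neq0 //.
    by move/weight_neq0 => [].
  exact: weight_chain.
Qed.

Let xi_neq0 x : K x -> xi x != 0.
Proof.
move=> Kx; have [z xz] := K_supp Kx.
have [_ _ /in_order_complex[xI _]] := Kx.
have [a [b [az bA bz]]] := below_ex (xI z xz).
apply: (@coord_neq0 _ a b); rewrite !coord_xi ?ltrD2r //; first exact: mass_lt az _ bz.
exact: fintype.subsetP (below_A (xI z xz)) _ az.
Qed.

Let xi_continuous (S : topologicalType) (h : S -> {ptws L -> R}) s :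
  {for s, continuous h} -> {for s, continuous (fun q => xi (h q))}.
Proof.
move=> ch; apply: mx_continuous_at => i j.
have cm a : {for s, continuous (fun q => mass (h q) a)}.
  by apply: sum_continuous_at => z; exact: eval_continuous.
rewrite (_ : (fun _ => _) = (fun q => mass (h q) (atom j) - mass (h q) a0)).
  by apply: sub_continuous_at.
by apply/funext => q; rewrite mxE.
Qed.

Let normalize_continuous (S : topologicalType) (h : S -> 'rV[R]_n) s : h s != 0 ->
  {for s, continuous h} -> {for s, continuous (fun q => normalize (h q))}.
Proof.
move=> hs ch; apply: mx_continuous_at => i j.
have cj k : {for s, continuous (fun q => h q 0 k)}.
  apply: (@continuous_comp _ _ _ h (fun M : 'rV[R]_n => M 0 k)) => //.
  exact: coord_continuous.
rewrite (_ : (fun _ => _) = (fun q => (Num.sqrt (norm2 (h q)))^-1 * h q 0 j)); last first.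
  by apply/funext => q; rewrite mxE (ord1 i).
apply: mul_continuous_at => //; apply: cvgV.
  by rewrite sqrtr_eq0 -ltNge norm2_gt0.
apply: (@continuous_comp _ _ _ (fun q => norm2 (h q)) Num.sqrt);
  last exact: sqrt_continuous.
apply: sum_continuous_at => k.
by apply: mul_continuous_at.
Qed.

Let from_sphere_continuous w : w != 0 -> {for w, continuous from_sphere}.
Proof.
move=> w0; apply: ptws_continuous_at => z.
have cc a : {for w, continuous (fun q => coord q a)}.
  by apply: sum_continuous_at => i; exact: coord_continuous.
have cw y : {for w, continuous (fun q => weight q y)}.
  rewrite /weight; case: (_ && _); last exact: cst_continuous_at.
  apply: prod_continuous_at => a; apply: prod_continuous_at => b.
  apply: max_continuous_at; first exact: cst_continuous_at.
  exact: sub_continuous_at.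
apply: (@mul_continuous_at _ _ (fun q => weight q z)) => //.
apply: (@cvgV _ _ (nbhs w) _ (fun q => \sum_y weight q y)).
  by rewrite gt_eqF // weight_sum.
exact: sum_continuous_at.
Qed.

(** Starting from [x] in the complex, each [r y] with [y] in the support of [x] is the join of a
    level set of [mass x], as is each element in the support of the round trip, so all are
    comparable and [homotopic_push] applies. On the sphere, a level set of [w] separates the
    coordinates of [w] and of its image strictly in the same direction, so the segment between them
    avoids 0 and can be normalized. *)
Lemma open_itv_sphere :
  homotopy_equivalent R (realization R (order_complex (open_itv u v))) (unit_sphere R n).
Proof.
exists to_sphere, from_sphere.
have c_to x : K x -> {for x, continuous to_sphere}.
  move=> Kx; apply: normalize_continuous; first exact: xi_neq0.
  by apply: xi_continuous; exact: cvg_id.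
split.
- split; first exact: within_continuous_at.
  by move=> x /xi_neq0/normalize_sphere.
- split; first by apply: within_continuous_at => w /sphere_neq0/from_sphere_continuous.
  by move=> w /sphere_neq0/from_sphere_K.
- apply: (homotopic_push (r := r)) => //.
  + move=> x Kx; apply: continuous_comp; first exact: c_to.
    by apply: from_sphere_continuous; apply/sphere_neq0/normalize_sphere/xi_neq0.
  + by move=> x /xi_neq0/normalize_sphere/sphere_neq0/from_sphere_K.
  + move=> x z y Kx /=; have tx0 := sphere_neq0 (normalize_sphere (xi_neq0 Kx)).
    have [_ _ /in_order_complex[xI _]] := Kx.
    rewrite from_sphere_neq0 // => wz xy; apply: weight_chain wz _.
    apply/weight_neq0; split; [exact/r_in/xI|by rewrite /r below_r|].
    rewrite below_r => a b ay bA by_; rewrite !coordZ ltr_pM2l.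
      rewrite !coord_xi ?ltrD2r //; first exact: mass_lt ay _ by_.
      exact: fintype.subsetP (below_A (xI y xy)) _ ay.
    by rewrite invr_gt0 sqrtr_gt0 norm2_gt0 // xi_neq0.
- pose H (p : R * 'rV[R]_n) := (1 - p.1) *: xi (from_sphere p.2) + p.1 *: p.2.
  have H0 p : (`[0, 1] `*` unit_sphere R n) p -> H p != 0.
    case: p => t w [/= t01 /sphere_neq0 w0].
    have [t0 t1] : 0 <= t /\ t <= 1 by move: t01; rewrite in_itv /= => /andP[].
    have [z wz] := weight_ex w0; have /weight_neq0[zI _ hz] := wz.
    have [a [b [az bA bz]]] := below_ex zI.
    have aA := fintype.subsetP (below_A zI) _ az.
    apply: (@coord_neq0 _ a b); rewrite /H !coordD !coordZ !coord_xi //=.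
    have := mass_lt (from_sphere_K w0) _ az bA bz; rewrite from_sphere_neq0 // => /(_ wz).
    have := hz a b az bA bz; move: (mass _ a) (mass _ b) (mass _ a0) => ma mb m0.
    move: (coord w a) (coord w b) => ca cb cba mba.
    have [tp|tn] := ltP 0 t; last by rewrite (_ : t = 0); lra.
    have : 0 < t * (ca - cb) by apply: mulr_gt0 => //; lra.
    have : 0 <= (1 - t) * (ma - mb) by apply: mulr_ge0; lra.
    by lra.
  exists (fun p => normalize (H p)); split.
  + apply: within_continuous_at => p Sp; apply: normalize_continuous; first exact: H0.
    have [_ /sphere_neq0 w0] := Sp.
    have c1 : {for p, continuous (fun q : R * 'rV[R]_n => q.1)} by exact: cvg_fst.
    have c2 : {for p, continuous (fun q : R * 'rV[R]_n => q.2)} by exact: cvg_snd.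
    apply: cvgD; apply: cvgZ => //.
      by apply: sub_continuous_at => //; exact: cst_continuous_at.
    apply: (@xi_continuous _ (fun q : R * 'rV[R]_n => from_sphere q.2)).
    apply: (@continuous_comp _ _ _ snd from_sphere) => //.
    exact: from_sphere_continuous.
  + by move=> p /H0/normalize_sphere.
  + by move=> w _; rewrite /H /= subr0 scale1r scale0r addr0.
  + move=> w; rewrite inE => Sw.
    by rewrite /H /= subrr scale0r add0r scale1r normalize_id.
Qed.

End Sphere.

Lemma open_itv_homotopy_type : exists n : nat,
  homotopy_equivalent R (realization R (order_complex (open_itv u v))) (unit_ball R n)
  \/ homotopy_equivalent R (realization R (order_complex (open_itv u v))) (unit_sphere R n).
Proof.
have [jv|jv] := eqVneq (join_of u A) v; last by exists 0%N; left; exact: open_itv_ball.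
have [a aA] := covers_below_neq0 uv.
by exists #|(A :\ a)%SET|; right; exact: open_itv_sphere.
Qed.

End OpenIntervals.

(** * Independence of covers for simple polytopes, and the conclusion *)

Lemma simple_independent_covers (R : realType) (d : nat) (P : set 'rV[R]_d)
    (c : 'rV[R]_d) (disp : Order.disp_t) (L : finLatticeType disp)
    (vtx : L -> 'rV[R]_d) (u : L) :
  simple_polytope P -> generic_cost P c -> skeleton_is_hasse_diagram P c vtx ->
  independent_covers u.
Proof.
move=> sP gP hP S a /fintype.subsetP SC /upper_coversP ua aS.
have uS z : z \in S -> covers u z by move=> /SC/upper_coversP.
apply: (cover_not_le_join (cost_inj gP hP) (cost_covers hP)
  (lattice_face_ascent sP gP hP) (lattice_face_pair sP gP hP)
  (lattice_face_span sP gP hP) uS ua aS) => y uy Sy.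
by rewrite join_of_le uy; apply/forall_inP.
Qed.

Theorem theorem4p11 (R : realType) (d : nat) (P : set 'rV[R]_d)
    (c : 'rV[R]_d) (disp : Order.disp_t) (L : finLatticeType disp)
    (vtx : L -> 'rV[R]_d) :
  simple_polytope P -> generic_cost P c ->
  skeleton_is_hasse_diagram P c vtx ->
  (forall u v : L, (u < v)%O ->
     exists n : nat,
       homotopy_equivalent R (realization R (order_complex (open_itv u v)))
         (unit_ball R n)
       \/ homotopy_equivalent R (realization R (order_complex (open_itv u v)))
         (unit_sphere R n)) /\
  (forall u v : L, (u <= v)%O -> mobius u v \in [:: 0; 1; -1]).
Proof.
move=> sP gP hP.
have indep u := simple_independent_covers (u := u) sP gP hP.
split=> u v uv; first exact: open_itv_homotopy_type.
exact: mobius_values.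
Qed.
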